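(* Let $X$, $Y_1$, $Y_2$ be locally compact Hausdorff spaces and let $\mu_1:Y_1\to X$ and $\mu_2:Y_2\to X$ be continuous maps. The flip map $\tau:C_0(Y_1)\otimes^{\mathrm h}_{C_0(X)}C_0(Y_2)\to C_0(Y_2)\otimes^{\mathrm h}_{C_0(X)}C_0(Y_1)$, $b_1\otimes b_2\mapsto b_2\otimes b_1$, has $$\|\tau\|_{\mathrm{cb}}=\sqrt{\max_{x\in X}\,\min_{i=1,2}\,\#\mu_i^{-1}(x)}.$$ (If one side of the equation is infinite, then so is the other.)
   Context: $C_0(Y)$ is the $C^*$-algebra of continuous complex-valued functions vanishing at infinity on a locally compact Hausdorff space $Y$. Pullback of functions along $\mu_i$ gives a nondegenerate $*$-homomorphism $\mu_i^*:C_0(X)\to M(C_0(Y_i))$ (multiplier algebra), through which $C_0(Y_i)$ is a $C_0(X)$-bimodule. Haagerup tensor product: let $B_1,B_2$ be $C^*$-algebras which are $A$-bimodules via nondegenerate $*$-homomorphisms $A\to M(B_i)$ from a $C^*$-algebra $A$. Let $B_1\otimes_A B_2$ be the algebraic balanced tensor product; undecorated $\otimes$ is the algebraic tensor product over $\mathbb{C}$; $M_{n,m}$ denotes complex $n\times m$ matrices and $M_n=M_{n,n}$. Define $\odot:(M_{n,m}\otimes B_1)\otimes(M_{m,n}\otimes B_2)\to M_n\otimes(B_1\otimes_A B_2)$ by $(d\otimes b_1)\odot(e\otimes b_2)=de\otimes(b_1\otimes b_2)$. Give $M_n\otimes B$ its $C^*$-norm and $M_{n,m}\otimes B$ the norm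 inherited as a subspace of $M_{\max(n,m)}\otimes B$. The Haagerup seminorm of $F\in M_n\otimes(B_1\otimes_A B_2)$ is $$\|F\|_{\mathrm h}=\inf\{\|D\|\,\|E\| : m\in\mathbb{N},\ D\in M_{n,m}\otimes B_1,\ E\in M_{m,n}\otimes B_2,\ F=D\odot E\}.$$ $B_1\otimes^{\mathrm h}_A B_2$ is the separated completion of $B_1\otimes_A B_2$ in the seminorm for $n=1$; the Haagerup (semi)norms extend to the spaces $M_n\otimes(B_1\otimes_A^{\mathrm h}B_2)$ and make it an operator space. The flip $\tau$ is defined on the algebraic tensor product $C_0(Y_1)\otimes_{C_0(X)}C_0(Y_2)$, and $\|\tau\|_{\mathrm{cb}}\in[0,\infty]$ is the supremum over $n$ of the operator norms of $\mathrm{id}_{M_n}\otimes\tau$ with respect to the Haagerup (semi)norms (if finite, $\tau$ extends to the completions with the same cb norm). $\#S\in\{0,1,2,\dots,\infty\}$ denotes cardinality, and $\max_{x\in X}$ is understood as a supremum in $[0,\infty]$. *)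

(* Defs.v *)
From HB Require Import structures.
From mathcomp Require Import all_boot all_order all_algebra.
From mathcomp Require Import generic_quotient ring_quotient.
From mathcomp Require Import all_classical all_reals all_analysis.
From mathcomp Require Import complex freeg.

Set Implicit Arguments.
Unset Strict Implicit.
Unset Printing Implicit Defensive.

Import Order.TTheory GRing.Theory Num.Theory.
Import numFieldNormedType.Exports.
Import ComplexField.

Local Open Scope classical_set_scope.
Local Open Scope ring_scope.
Local Open Scope quotient_scope.

(* [A] is a commutative algebra in the intended use, so the right action on
   [B1] and the left action on [B2] are both plain functions [A -> B -> B].
   The tensor product is the free [K]-module on the set [B1 * B2] divided by
   the span of the bilinearity and balancing relations; [<< p >>] is the basis
   vector of [p]. *)

Section BalancedTensor.
Context {K : comNzRingType} {A : Type} {B1 B2 : lmodType K}.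
Variables (act1 : A -> B1 -> B1) (act2 : A -> B2 -> B2).

Local Notation F := {freeg (B1 * B2)%type / K}.

Inductive tensor_relator : F -> Prop :=
| TensorAddl x x' y :
    tensor_relator (<< (x + x', y) >> - << (x, y) >> - << (x', y) >>)
| TensorAddr x y y' :
    tensor_relator (<< (x, y + y') >> - << (x, y) >> - << (x, y') >>)
| TensorScalel c x y : tensor_relator (<< (c *: x, y) >> - c *: << (x, y) >>)
| TensorScaler c x y : tensor_relator (<< (x, c *: y) >> - c *: << (x, y) >>)
| TensorBalanced a x y :
    tensor_relator (<< (act1 a x, y) >> - << (x, act2 a y) >>).

(* the linear span of [tensor_relator] *)
Definition tensor_null : {pred F} := fun u =>
  `[< forall S : {pred F}, GRing.submod_closed S ->
      (forall r, tensor_relator r -> r \in S) -> u \in S >].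

Lemma tensor_null_submod : GRing.submod_closed tensor_null.
Proof.
split=> [|c u v /asboolP hu /asboolP hv]; apply/asboolP => S hS hr.
  by case: hS.
by case: (hS) => _; apply; [exact: hu|exact: hv].
Qed.

Lemma tensor_relator_null r : tensor_relator r -> r \in tensor_null.
Proof. by move=> hr; apply/asboolP => S _; apply. Qed.

HB.instance Definition _ := GRing.isZmodClosed.Build F tensor_null
  (GRing.submod_closedB tensor_null_submod).

Definition balanced_tensor : Type := Quotient.quot tensor_null.

HB.instance Definition _ := GRing.Zmodule.on balanced_tensor.

Definition tensor_pi (u : F) : balanced_tensor := \pi_(Quotient.quot tensor_null) u.

Lemma tensor_piD u v : tensor_pi (u + v) = tensor_pi u + tensor_pi v.
Proof. exact: raddfD. Qed.

Lemma tensor_pi_eq u v : (tensor_pi u = tensor_pi v) <-> (u - v \in tensor_null).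
Proof. by rewrite Quotient.idealrBE; split=> [/eqP|/eqP]. Qed.

Lemma tensor_nullZ c u : u \in tensor_null -> c *: u \in tensor_null.
Proof.
by case: tensor_null_submod => h0 h hu; rewrite -[c *: u]addr0; exact: h.
Qed.

Definition tensor_repr (t : balanced_tensor) : F :=
  repr (t : Quotient.quot tensor_null).

Lemma tensor_reprK t : tensor_pi (tensor_repr t) = t.
Proof. exact: reprK. Qed.

Definition tensor_scale c (t : balanced_tensor) := tensor_pi (c *: tensor_repr t).

Lemma tensor_scale_pi c u : tensor_scale c (tensor_pi u) = tensor_pi (c *: u).
Proof.
apply/tensor_pi_eq; rewrite -scalerBr; apply: tensor_nullZ.
by apply/tensor_pi_eq; rewrite tensor_reprK.
Qed.

Fact tensor_scaleA a b t :
  tensor_scale a (tensor_scale b t) = tensor_scale (a * b) t.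
Proof. by rewrite -(tensor_reprK t) !tensor_scale_pi scalerA. Qed.

Fact tensor_scale1 : left_id 1 tensor_scale.
Proof. by move=> t; rewrite -{1}(tensor_reprK t) tensor_scale_pi scale1r tensor_reprK. Qed.

Fact tensor_scaleDr : right_distributive tensor_scale +%R.
Proof.
move=> c t s; rewrite -(tensor_reprK t) -(tensor_reprK s).
by rewrite -tensor_piD !tensor_scale_pi scalerDr tensor_piD.
Qed.

Fact tensor_scaleDl t : {morph tensor_scale^~ t : a b / a + b}.
Proof.
by move=> a b /=; rewrite -(tensor_reprK t) !tensor_scale_pi scalerDl tensor_piD.
Qed.

HB.instance Definition _ := GRing.Zmodule_isLmodule.Build K balanced_tensor
  tensor_scaleA tensor_scale1 tensor_scaleDr tensor_scaleDl.

Definition tens (x : B1) (y : B2) : balanced_tensor := tensor_pi << (x, y) >>.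

End BalancedTensor.

Section TensorLift.
Context {K : comNzRingType} {A : Type} {B1 B2 M : lmodType K}.
Variables (act1 : A -> B1 -> B1) (act2 : A -> B2 -> B2).

Local Notation T := (balanced_tensor act1 act2).

(* meaningful only for [balanced_bilinear f], when the choice of the
   representative does not matter (see [tensor_lift_tens]) *)
Definition tensor_lift (f : B1 -> B2 -> M) (t : T) : M :=
  fglift (fun p => f p.1 p.2) (tensor_repr t).

Record balanced_bilinear (f : B1 -> B2 -> M) : Prop := BalancedBilinear {
  balanced_addl : forall x x' y, f (x + x') y = f x y + f x' y;
  balanced_addr : forall x y y', f x (y + y') = f x y + f x y';
  balanced_scalel : forall c x y, f (c *: x) y = c *: f x y;
  balanced_scaler : forall c x y, f x (c *: y) = c *: f x y;
  balanced_act : forall a x y, f (act1 a x) y = f x (act2 a y) }.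

Section Universal.
Variables (f : B1 -> B2 -> M) (hf : balanced_bilinear f).

Local Notation F := {freeg (B1 * B2)%type / K}.
Local Notation g := (fun p : B1 * B2 => f p.1 p.2).

Let h : {additive F -> M} :=
  HB.pack (fglift g : F -> M)
    (GRing.isZmodMorphism.Build F M (fglift g) (lift_is_additive g)).

Let hU c p : h << c *g p >> = c *: g p.
Proof. exact: liftU. Qed.

Let hZ c u : h (c *: u) = c *: h u.
Proof.
rewrite -{2}(freeg_sumE u) [c *: u]/(fgscale c u) /fgscale !raddf_sum /=.
by apply: eq_bigr => p _; rewrite !liftU scalerA.
Qed.

Let h_null u : u \in tensor_null act1 act2 -> h u = 0.
Proof.
pose S : {pred F} := fun v => h v == 0.
have inS v : (v \in S) = (h v == 0) by [].
move=> /asboolP/(_ S) hu; apply/eqP; rewrite -inS; apply: hu.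
  split=> [|c v w]; first by rewrite inS raddf0.
  by rewrite !inS raddfD hZ => /eqP-> /eqP->; rewrite scaler0 addr0.
move=> r; case=> *; rewrite inS !raddfB ?hZ !hU /= !scale1r.
- by rewrite balanced_addl// addrAC addrK subrr.
- by rewrite balanced_addr// addrAC addrK subrr.
- by rewrite balanced_scalel// subrr.
- by rewrite balanced_scaler// subrr.
- by rewrite balanced_act// subrr.
Qed.

Lemma tensor_lift_pi (u : F) :
  tensor_lift f (tensor_pi act1 act2 u) = fglift (fun p => f p.1 p.2) u.
Proof.
apply/eqP; rewrite -subr_eq0; apply/eqP.
rewrite -[RHS](@h_null (tensor_repr (tensor_pi act1 act2 u) - u)) ?raddfB//.
by apply/tensor_pi_eq; rewrite tensor_reprK.
Qed.

Lemma tensor_lift_tens x y : tensor_lift f (tens act1 act2 x y) = f x y.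
Proof. by rewrite tensor_lift_pi liftU scale1r. Qed.

Lemma tensor_lift_linear : linear (tensor_lift f).
Proof.
move=> c t s; rewrite -(tensor_reprK t) -(tensor_reprK s).
have -> : c *: tensor_pi act1 act2 (tensor_repr t)
    = tensor_pi act1 act2 (c *: tensor_repr t) by exact: tensor_scale_pi.
by rewrite -tensor_piD !tensor_lift_pi -[LHS]/(h (_ + _)) raddfD hZ.
Qed.

End Universal.
End TensorLift.

Section TensorBalanced.
Context {K : comNzRingType} {A : Type} {B1 B2 : lmodType K}.
Variables (act1 : A -> B1 -> B1) (act2 : A -> B2 -> B2).

Lemma tens_balanced : balanced_bilinear act1 act2 (tens act1 act2).
Proof.
split; rewrite /tens.
- move=> x x' y; rewrite -tensor_piD; apply/tensor_pi_eq.
  by rewrite opprD addrA; apply: tensor_relator_null; exact: (TensorAddl act1 act2).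
- move=> x y y'; rewrite -tensor_piD; apply/tensor_pi_eq.
  by rewrite opprD addrA; apply: tensor_relator_null; exact: (TensorAddr act1 act2).
- move=> c x y; rewrite [RHS](tensor_scale_pi act1 act2); apply/tensor_pi_eq.
  by apply: tensor_relator_null; exact: (TensorScalel act1 act2).
- move=> c x y; rewrite [RHS](tensor_scale_pi act1 act2); apply/tensor_pi_eq.
  by apply: tensor_relator_null; exact: (TensorScaler act1 act2).
- move=> a x y; apply/tensor_pi_eq.
  by apply: tensor_relator_null; exact: (TensorBalanced act1 act2).
Qed.

End TensorBalanced.

Section Flip.
Context {K : comNzRingType} {A : Type} {B1 B2 : lmodType K}.
Variables (act1 : A -> B1 -> B1) (act2 : A -> B2 -> B2).

Definition tensor_flip :
    balanced_tensor act1 act2 -> balanced_tensor act2 act1 :=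
  tensor_lift (fun x y => tens act2 act1 y x).

Lemma flip_balanced :
  balanced_bilinear act1 act2 (fun x y => tens act2 act1 y x).
Proof.
have [hl hr hsl hsr ha] := tens_balanced act2 act1.
by split=> *; rewrite ?hl ?hr ?hsl ?hsr ?ha.
Qed.

Lemma tensor_flip_tens x y :
  tensor_flip (tens act1 act2 x y) = tens act2 act1 y x.
Proof. exact: (tensor_lift_tens flip_balanced). Qed.

Lemma tensor_flip_linear : linear (tensor_flip).
Proof. exact: (tensor_lift_linear flip_balanced). Qed.

End Flip.

Section C0.
Context {R : realType}.

(* real-valued modulus; the library norm on R[i] is R[i]-valued *)
Local Notation modc := (@Normc.normc R).

Definition vanishes_at_infinity (Y : topologicalType) (f : Y -> R[i]) : Prop :=
  forall e : R, 0 < e ->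
    exists2 K : set Y, compact K & forall y, ~ K y -> modc (f y) < e.

Lemma modc_ge0 z : 0 <= modc z.
Proof. by case: z => a b; exact: sqrtr_ge0. Qed.

Lemma normr_modc (z : R[i]) : `|z| = (modc z)%:C%C.
Proof. by []. Qed.

Lemma modc_continuous : continuous (modc : R[i]^o -> R).
Proof.
move=> z; have FF : Filter (nbhs (z : R[i]^o)) by exact: nbhs_filter.
apply/(@cvgrPdist_lt R R^o _ (nbhs (z : R[i]^o)) _ (modc : R[i]^o -> R)) => e e0.
have e0' : 0 < e%:C%C by rewrite ltcR.
have := @nbhsx_ballx R[i] R[i]^o z _ e0'.
apply: filterS => w; rewrite -ball_normE /= normr_modc ltcR; apply: le_lt_trans.
have H (x y : R[i]) : modc x - modc y <= modc (x - y).
  by rewrite lerBlDr -{1}(subrK y x) le_normcD.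
suff : `|modc z - modc w| <= modc (z - w) by [].
by rewrite ler_norml H andbT lerNl opprB (le_trans (H _ _))// -normcN opprB.
Qed.

Section Def.
Variable Y : topologicalType.

Definition is_C0 : {pred (Y -> R[i])} := fun f =>
  `[< continuous (f : Y -> R[i]^o) /\ vanishes_at_infinity f >].

Lemma is_C0_submod : GRing.submod_closed is_C0.
Proof.
split.
  apply/asboolP; split; first by move=> x; exact: cvg_cst.
  by move=> e e0; exists set0; [exact: compact0|move=> y _; rewrite Normc.normc0].
move=> c f g /asboolP[fc f0] /asboolP[gc g0]; apply/asboolP; split.
  by move=> x; apply: cvgD; [apply: cvgZ; [exact: cvg_cst|exact: fc]|exact: gc].
move=> e e0.
have c0 : 0 < modc c + 1 by rewrite ltr_wpDl// modc_ge0.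
have [K cK hK] := f0 (e / 2 / (modc c + 1)) ltac:(by rewrite !divr_gt0).
have [L cL hL] := g0 (e / 2) ltac:(by rewrite divr_gt0).
exists (K `|` L); first exact: compactU.
move=> y /not_orP[/hK fy /hL gy].
have -> : (c *: f + g) y = c * f y + g y by [].
rewrite (le_lt_trans (le_normcD _ _))// [ltRHS](splitr e) ler_ltD//.
rewrite Normc.normcM.
move: fy; rewrite ltr_pdivlMr// => /ltW; apply: le_trans.
by rewrite mulrC ler_wpM2l ?modc_ge0// lerDl.
Qed.

HB.instance Definition _ := GRing.isSubmodClosed.Build R[i] (Y -> R[i]) is_C0
  is_C0_submod.

Record C0 : Type := MkC0 { C0fun :> Y -> R[i]; C0P : C0fun \in is_C0 }.

HB.instance Definition _ := [isSub for C0fun].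
HB.instance Definition _ := [Choice of C0 by <:].
HB.instance Definition _ := [SubChoice_isSubLmodule of C0 by <:].

End Def.

Section Action.
Variables (X Y : topologicalType) (mu : continuousType Y X).

Lemma C0_bounded (a : C0 X) :
  exists2 M : R, 0 < M & forall x, modc (a x) <= M.
Proof.
have /asboolP[ac a0] := C0P a.
have [K cK hK] := a0 1 ltr01.
have cmod : continuous (fun x => modc (a x)).
  move=> x; apply: (@continuous_comp X R[i]^o R (a : X -> R[i]^o) modc);
    [exact: ac|exact: modc_continuous].
have [M [_ hM]] := compact_bounded
  (continuous_compact (continuous_subspaceT cmod) cK).
exists (`|M| + 1); first by rewrite ltr_wpDl.
move=> x; have [Kx|/hK/ltW ax] := pselect (K x); last first.
  by rewrite (le_trans ax)// lerDr.
apply: le_trans (ler_norm _) _; apply: (hM (`|M| + 1)); last by exists x.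
by rewrite (le_lt_trans (ler_norm _))// ltrDl.
Qed.

Lemma is_C0_pullback (a : C0 X) (b : C0 Y) :
  (fun y => a (mu y) * b y) \in @is_C0 Y.
Proof.
have /asboolP[ac _] := C0P a; have /asboolP[bc b0] := C0P b.
apply/asboolP; split.
  move=> y; apply: (@cvgZ R[i] R[i]^o); last exact: bc.
  apply: (@continuous_comp _ _ _ mu (a : X -> R[i]^o)); last exact: ac.
  exact: cts_fun.
move=> e e0; have [M M0 hM] := C0_bounded a.
have [K cK hK] := b0 (e / M) (divr_gt0 e0 M0).
exists K => // y /hK; rewrite ltr_pdivlMr// Normc.normcM; apply: le_lt_trans.
by rewrite mulrC ler_wpM2l ?modc_ge0.
Qed.

(* [a . b = mu^*(a) b]; the module structure is symmetric, so this is also the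
   right action [b . a] *)
Definition C0_act (a : C0 X) (b : C0 Y) : C0 Y := MkC0 (is_C0_pullback a b).

End Action.

Definition l2norm n (v : 'cV[R[i]]_n) : R :=
  Num.sqrt (\sum_i modc (v i ord0) ^+ 2).

Definition opnorm n (A : 'M[R[i]]_n) : R :=
  sup [set l2norm (A *m v) | v in [set v | l2norm v <= 1]].

Section MatrixNorm.
Variable Y : topologicalType.

(* the C*-norm of [M_n (x) C_0(Y) = C_0(Y, M_n)]; for empty [Y] it is
   [sup set0 = 0] *)
Definition Cstar_norm n (D : 'M[C0 Y]_n) : R :=
  sup [set opnorm (map_mx (fun b : C0 Y => b y) D) | y in [set: Y]].

(* extension by zero to a square matrix: the norm on [M_{p,q} (x) C_0(Y)] is
   inherited from [M_{max(p,q)} (x) C_0(Y)] *)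
Definition mx_pad p q (D : 'M[C0 Y]_(p, q)) : 'M[C0 Y]_(maxn p q) :=
  \matrix_(i, j) match insub (val i), insub (val j) with
                 | Some i', Some j' => D i' j'
                 | _, _ => 0
                 end.

Definition rect_norm p q (D : 'M[C0 Y]_(p, q)) : R := Cstar_norm (mx_pad D).

End MatrixNorm.

Section Haagerup.
Variables (X Y1 Y2 : topologicalType).
Variables (mu1 : continuousType Y1 X) (mu2 : continuousType Y2 X).

Definition C0_tensor := balanced_tensor (C0_act mu1) (C0_act mu2).

(* [M_n (x) V] is encoded as the matrices with entries in [V], so that
   [(d (x) b1) odot (e (x) b2) = de (x) (b1 (x) b2)] becomes the row-by-column
   product *)
Definition odot n m (D : 'M[C0 Y1]_(n, m)) (E : 'M[C0 Y2]_(m, n)) :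
    'M[C0_tensor]_n :=
  \matrix_(i, j) \sum_k tens (C0_act mu1) (C0_act mu2) (D i k) (E k j).

Definition haagerup_norm n (F : 'M[C0_tensor]_n) : \bar R :=
  ereal_inf [set x | exists m (D : 'M[C0 Y1]_(n, m)) (E : 'M[C0 Y2]_(m, n)),
    F = odot D E /\ x = (rect_norm D * rect_norm E)%:E].

End Haagerup.

(* supremum in [0, +oo]; unlike [ereal_sup], it is 0 on the empty set *)
Definition nonneg_sup (S : set (\bar R)) : \bar R := ereal_sup (0%E |` S).

Section CbNorm.
Variables (X Y1 Y2 Z1 Z2 : topologicalType).
Variables (mu1 : continuousType Y1 X) (mu2 : continuousType Y2 X).
Variables (nu1 : continuousType Z1 X) (nu2 : continuousType Z2 X).

(* operator norm of [id_{M_n} (x) T] between the Haagerup seminorms *)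
Definition amplified_norm (T : C0_tensor mu1 mu2 -> C0_tensor nu1 nu2) (n : nat) :
    \bar R :=
  nonneg_sup [set haagerup_norm (map_mx T F) |
    F in [set F : 'M[C0_tensor mu1 mu2]_n | (haagerup_norm F <= 1)%E]].

Definition cb_norm (T : C0_tensor mu1 mu2 -> C0_tensor nu1 nu2) : \bar R :=
  nonneg_sup [set amplified_norm T n | n in [set: nat]].

End CbNorm.

Section C0Flip.
Variables (X Y1 Y2 : topologicalType).
Variables (mu1 : continuousType Y1 X) (mu2 : continuousType Y2 X).

Definition C0_flip : C0_tensor mu1 mu2 -> C0_tensor mu2 mu1 :=
  @tensor_flip R[i] (C0 X) (C0 Y1) (C0 Y2) (C0_act mu1) (C0_act mu2).

End C0Flip.
End C0.

Arguments C0 R Y : clear implicits.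
Arguments C0_flip R {X Y1 Y2} mu1 mu2.
Arguments C0_tensor R {X Y1 Y2} mu1 mu2.

(* Main.v *)
Require Import Defs.
From HB Require Import structures.
From mathcomp Require Import all_boot all_order all_algebra.
From mathcomp Require Import all_classical all_reals all_analysis.
From mathcomp Require Import cyclic separable cyclotomic complex finmap ring lra.

(** Write N for the supremum over x of the smaller of the two fibre
    cardinalities, and D, E for the factors of F = D odot E.

    Upper bound.  Over a point x whose fibre in Y1 is y_1, ..., y_p with p <= N,
    replace D by the combination of the constant matrices D(y_l) with bump
    functions beta_l of disjoint supports: the error vanishes on the fibre, hence
    is small on the preimage of a whole neighbourhood of x
    ([small_near_fibre]).  Now D(y_l) has entries in C, so it can be moved
    across the tensor sign, and the flip of sum_l D(y_l) beta_l (x) E is the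
    product of the row (D(y_1) E, ..., D(y_p) E), whose norm is at most
    sqrt p |D| |E|, with the column of the beta_l, which has norm at most 1
    ([local_flip]).  If it is the fibre in Y2 that is small, do the same with E
    after transposing and exchanging the roles of Y1 and Y2.  The local
    factorizations are glued by functions rho_s on X with sum_s rho_s^2 <= 1,
    which act through the balancing relation; one factor rho_s goes to each leg
    of the tensor, so the glued norm is the largest of the local ones
    ([flip_upper]).  For the gluing to be a mere addition, factorizations are
    measured pointwise against a weight on X ([haagerup_factor]).  All error
    terms, including the part of D outside a large compact set, are handled by
    [haagerup_factor_crude], a bound that loses a constant depending only on the
    size and norm of the factorization, which is fixed before the errors are
    chosen.

    Lower bound.  Take n distinct points y_i of Y1 and n distinct points z_j of
    Y2 over the same x, with disjoint bumps b_i, c_j.  Let U be the cyclic shift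
    and V the diagonal matrix of the n-th roots of unity.  The element
    F = (sum_i b_i U^i) odot (sum_j c_j V^j) has norm at most 1.  If its flip
    factors as P odot Q then evaluation at (z_j, y_i) gives
    P(z_j) Q(y_i) = U^i V^j.  Pairing this with U^i V^j, using Cauchy-Schwarz,
    and using that the average of V^-j W V^j over j is the diagonal of W
    (Parseval for the Fourier matrix), forces n <= |P|^2 |Q|^2
    ([shift_clock_bound], [flip_lower]). *)

Set Implicit Arguments.
Unset Strict Implicit.
Unset Printing Implicit Defensive.

Import Order.TTheory GRing.Theory Num.Theory.
Import numFieldNormedType.Exports.
Import ComplexField.

Local Open Scope classical_set_scope.
Local Open Scope ring_scope.

(** * Operator norms of finite complex matrices *)

Section FiniteNorm.
Context {R : realType}.
Local Notation C := R[i].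
Local Notation modc := (@Normc.normc R).

Lemma modcM (a b : C) : modc (a * b) = modc a * modc b.
Proof. exact: Normc.normcM. Qed.

Lemma modc_conj (a : C) : modc (conjc a) = modc a.
Proof. by case: a => a b; rewrite /= sqrrN. Qed.

Lemma modc_real (r : R) : modc (r%:C)%C = `|r|.
Proof. by rewrite /= expr0n addr0 sqrtr_sqr. Qed.

Lemma modc_sqrC (a : C) : ((modc a ^+ 2)%:C)%C = a * conjc a.
Proof. by rewrite rmorphXn -sqr_normc. Qed.

Lemma modc_sum (I : finType) (f : I -> C) : modc (\sum_i f i) <= \sum_i modc (f i).
Proof.
elim/big_ind2: _ => [|x1 x2 y1 y2 h1 h2|i _]; rewrite ?Normc.normc0 ?lexx//.
by rewrite (le_trans (le_normcD _ _))// lerD.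
Qed.

Definition sqnorm (I : finType) (v : I -> C) : R := \sum_i modc (v i) ^+ 2.

Lemma sqnorm_ge0 (I : finType) (v : I -> C) : 0 <= sqnorm v.
Proof. by apply: sumr_ge0 => i _; rewrite sqr_ge0. Qed.

Lemma sqnorm_ge (I : finType) (v : I -> C) i : modc (v i) ^+ 2 <= sqnorm v.
Proof. by rewrite /sqnorm (bigD1 i)//= lerDl sumr_ge0// => j _; rewrite sqr_ge0. Qed.

Lemma sqnorm_eq0 (I : finType) (v : I -> C) : sqnorm v = 0 -> forall i, v i = 0.
Proof.
move=> v0 i; apply: Normc.eq0_normc; apply/eqP; rewrite -sqrf_eq0.
by rewrite eq_le sqr_ge0 andbT -v0 sqnorm_ge.
Qed.

Lemma sqnormZ (I : finType) c (v : I ->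
  C) : sqnorm (fun i => c * v i) = modc c ^+ 2 * sqnorm v.
Proof. by rewrite /sqnorm mulr_sumr; apply: eq_bigr => i _; rewrite modcM exprMn. Qed.

Lemma eq_sqnorm (I : finType) (v w : I -> C) : (forall i, v i = w i) -> sqnorm v = sqnorm w.
Proof. by move=> e; apply: eq_bigr => i _; rewrite e. Qed.

(** Lagrange's identity: the defect is half the sum of the squares of
    [x i * y j - x j * y i]. *)
Lemma sum_CauchySchwarz (I : finType) (x y : I -> R) :
  (\sum_i x i * y i) ^+ 2 <= (\sum_i x i ^+ 2) * (\sum_i y i ^+ 2).
Proof.
have H : \sum_i \sum_j (x i * y j - x j * y i) ^+ 2 =
   2 * ((\sum_i x i ^+ 2) * (\sum_i y i ^+ 2) - (\sum_i x i * y i) ^+ 2).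
  have -> : 2 * ((\sum_i x i ^+ 2) * (\sum_i y i ^+ 2) - (\sum_i x i * y i) ^+ 2)
    = (\sum_i x i ^+ 2) * (\sum_i y i ^+ 2) + (\sum_i y i ^+ 2) * (\sum_i x i ^+ 2)
      - 2 * ((\sum_i x i * y i) * (\sum_i x i * y i)) by ring.
  rewrite !big_distrlr /= mulr_sumr -sumrN -!big_split /=; apply: eq_bigr => i _.
  rewrite mulr_sumr -sumrN -!big_split /=; apply: eq_bigr => j _; ring.
rewrite -subr_ge0 -(pmulr_rge0 _ (ltr0n R 2)) -H.
by do 2![apply: sumr_ge0 => ? _]; rewrite sqr_ge0.
Qed.

Lemma modc_CauchySchwarz (I : finType) (v w : I -> C) :
  modc (\sum_i v i * w i) ^+ 2 <= sqnorm v * sqnorm w.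
Proof.
apply: le_trans (sum_CauchySchwarz (fun i => modc (v i)) (fun i => modc (w i))).
have h0 (J : finType) (f : J -> C) : 0 <= \sum_i modc (f i).
  by apply: sumr_ge0 => i _; exact: modc_ge0.
rewrite ler_sqr ?nnegrE ?modc_ge0//.
  by apply: le_trans (modc_sum _) _; apply: ler_sum => i _; rewrite modcM.
by apply: sumr_ge0 => i _; rewrite mulr_ge0 ?modc_ge0.
Qed.

(** The squared operator norm of [a] is at most [c].  Squares, and index sets
    that are arbitrary finite types, let block matrices be bounded by adding up
    the bounds of their blocks. *)
Definition sqopnorm_le (I J : finType) (a : I -> J -> C) (c : R) : Prop :=
  forall v : J -> C, sqnorm (fun i => \sum_j a i j * v j) <= c * sqnorm v.

Lemma sqopnorm_leW (I J : finType) (a : I -> J -> C) c d : c <= d -> sqopnorm_le a c ->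
  sqopnorm_le a d.
Proof. by move=> cd h v; apply: le_trans (h v) _; rewrite ler_wpM2r ?sqnorm_ge0. Qed.

Lemma eq_sqopnorm_le (I J : finType) (a b : I -> J -> C) c :
  (forall i j, a i j = b i j) -> sqopnorm_le a c -> sqopnorm_le b c.
Proof.
move=> ab h v; apply: le_trans (h v); rewrite le_eqVlt; apply/orP; left; apply/eqP.
by apply: eq_sqnorm => i; apply: eq_bigr => j _; rewrite ab.
Qed.

Lemma sqopnorm_le_scale (I J : finType) (a : I -> J -> C) c (s : C) :
  sqopnorm_le a c -> sqopnorm_le (fun i j => s * a i j) (modc s ^+ 2 * c).
Proof.
move=> h v; rewrite -mulrA (le_trans _ (ler_wpM2l _ (h v))) ?sqr_ge0// -sqnormZ.
rewrite (@eq_sqnorm _ _ (fun i => s * (\sum_j a i j * v j)))// => i.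
by rewrite mulr_sumr; apply: eq_bigr => j _; rewrite mulrA.
Qed.

(** The norm of the transpose: with [u = a^T w] and [S = |u|^2], pairing gives
    [S = sum_i w_i (a conj(u))_i], hence [S^2 <= |w|^2 c S]. *)
Lemma sqopnorm_le_tr (I J : finType) (a : I -> J -> C) c : 0 <= c -> sqopnorm_le a c ->
  sqopnorm_le (fun j i => a i j) c.
Proof.
move=> c0 h w; set u := fun j => _; set S := sqnorm u.
have Su : (S%:C)%C = \sum_i w i * (\sum_j a i j * conjc (u j)).
  rewrite /S /sqnorm rmorph_sum /=.
  under eq_bigr do rewrite modc_sqrC /u mulr_suml.
  rewrite exchange_big /=; apply: eq_bigr => i _.
  by rewrite mulr_sumr; apply: eq_bigr => j _; rewrite mulrCA mulrA.
have uc : sqnorm (fun j => conjc (u j)) = S by apply: eq_bigr => j _; rewrite modc_conj.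
have S0 : 0 <= S by exact: sqnorm_ge0.
have : S ^+ 2 <= sqnorm w * (c * S).
  have := modc_CauchySchwarz w (fun i => \sum_j a i j * conjc (u j)).
  rewrite -Su modc_real ger0_norm// => /le_trans; apply.
  by rewrite ler_wpM2l ?sqnorm_ge0// -uc.
move: S0; rewrite le_eqVlt => /predU1P[<-|S0]; first by rewrite mulr_ge0 ?sqnorm_ge0.
by rewrite mulrA expr2 ler_pM2r// mulrC.
Qed.

Lemma sqopnorm_le_entry (I J : finType) (a : I -> J -> C) c i j : sqopnorm_le a c ->
  modc (a i j) ^+ 2 <= c.
Proof.
move=> /(_ (fun k => (k == j)%:R)).
have -> : sqnorm (fun k : J => (k == j)%:R : C) = 1.
  rewrite /sqnorm (bigD1 j)//= eqxx Normc.normc1 expr1n big1 ?addr0// => k /negPf->.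
  by rewrite Normc.normc0 expr0n.
rewrite mulr1; apply: le_trans.
rewrite (le_trans _ (sqnorm_ge _ i))// (bigD1 j)//= eqxx mulr1 big1 ?addr0// => k /negPf->.
by rewrite mulr0.
Qed.

Lemma sqopnorm_le_col (I J : finType) (a : I -> J -> C) c j : sqopnorm_le a c ->
  sqnorm (fun i => a i j) <= c.
Proof.
move=> /(_ (fun k => (k == j)%:R)).
have -> : sqnorm (fun k : J => (k == j)%:R : C) = 1.
  rewrite /sqnorm (bigD1 j)//= eqxx Normc.normc1 expr1n big1 ?addr0// => k /negPf->.
  by rewrite Normc.normc0 expr0n.
rewrite mulr1; apply: le_trans.
rewrite le_eqVlt; apply/orP; left; apply/eqP; apply: eq_sqnorm => i.
by rewrite (bigD1 j)//= eqxx mulr1 big1 ?addr0// => k /negPf->; rewrite mulr0.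
Qed.

Lemma sqopnorm_le_HS (I J : finType) (a : I -> J -> C) :
  sqopnorm_le a (\sum_i \sum_j modc (a i j) ^+ 2).
Proof.
move=> v; rewrite {1}/sqnorm mulr_suml; apply: ler_sum => i _.
by have := modc_CauchySchwarz (a i) v; rewrite /sqnorm.
Qed.

Lemma sqopnorm_le_comp (I J K : finType) (a : I -> J -> C) (b : J -> K -> C) c d :
  0 <= c -> sqopnorm_le a c -> sqopnorm_le b d ->
    sqopnorm_le (fun i k => \sum_j a i j * b j k) (c * d).
Proof.
move=> c0 ha hb v.
rewrite (@eq_sqnorm _ _ (fun i => \sum_j a i j * (\sum_k b j k * v k))).
  by rewrite (le_trans (ha _))// -mulrA ler_wpM2l.
move=> i; under eq_bigr do rewrite mulr_suml.
rewrite exchange_big /=; apply: eq_bigr => j _; rewrite mulr_sumr.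
by apply: eq_bigr => k _; rewrite mulrA.
Qed.

End FiniteNorm.

(** * Comparison with the norms defined by suprema *)

Section OperatorNorm.
Context {R : realType}.
Local Notation C := R[i].
Local Notation modc := (@Normc.normc R).

Lemma l2normE n (v : 'cV[C]_n) : l2norm v = Num.sqrt (sqnorm (fun i => v i ord0)).
Proof. by []. Qed.

Lemma sqnorm_mulmx m n (A : 'M[C]_(m, n)) (v : 'cV[C]_n) :
  sqnorm (fun i => (A *m v) i ord0) = sqnorm (fun i => \sum_j A i j * v j ord0).
Proof. by apply: eq_sqnorm => i; rewrite mxE. Qed.

Lemma sqopnorm_le_l2norm n (A : 'M[C]_n) c : 0 <= c ->
  sqopnorm_le (fun i j => A i j) (c ^+ 2) ->
  forall v, l2norm (A *m v) <= c * l2norm v.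
Proof.
move=> c0 h v; rewrite !l2normE sqnorm_mulmx -[in leRHS](ger0_norm c0) -sqrtr_sqr.
rewrite -sqrtrM ?sqr_ge0//.
exact: ler_wsqrtr (h (fun j => v j ord0)).
Qed.

Lemma l2norm0 n : l2norm (0 : 'cV[C]_n) = 0.
Proof.
by rewrite l2normE /sqnorm big1 ?sqrtr0// => i _; rewrite mxE Normc.normc0 expr0n.
Qed.

Lemma sup_ge0 (S : set R) : (forall x, S x -> 0 <= x) -> 0 <= sup S.
Proof.
move=> h; have [hs|/sup_out->//] := pselect (has_sup S).
by case: (hs) => -[x Sx] hub; apply: le_trans (h _ Sx) (ub_le_sup hub Sx).
Qed.

Lemma opnorm_ge0 n (A : 'M[C]_n) : 0 <= opnorm A.
Proof. by apply: sup_ge0 => _ [? _ <-]; rewrite l2normE sqrtr_ge0. Qed.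

Lemma opnorm_le n (A : 'M[C]_n) c : 0 <= c -> sqopnorm_le (fun i j => A i j) (c ^+ 2) ->
  opnorm A <= c.
Proof.
move=> c0 h; apply: ge_sup.
  by exists (l2norm (A *m 0)); exists 0 => //=; rewrite l2norm0.
move=> _ [v /= v1 <-]; apply: le_trans (sqopnorm_le_l2norm c0 h v) _.
by rewrite -[leRHS]mulr1 ler_wpM2l.
Qed.

Lemma opnorm_bd n (A : 'M[C]_n) : sqopnorm_le (fun i j => A i j) (opnorm A ^+ 2).
Proof.
have ub : has_ubound [set l2norm (A *m v) | v in [set v | l2norm v <= 1]].
  set c := \sum_i \sum_j modc (A i j) ^+ 2.
  have c0 : 0 <= c by do 2![apply: sumr_ge0 => ? _]; rewrite sqr_ge0.
  exists (Num.sqrt c) => _ [v /= v1 <-].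
  apply: le_trans (sqopnorm_le_l2norm (sqrtr_ge0 c) _ v) _.
    by rewrite sqr_sqrtr//; exact: sqopnorm_le_HS.
  by rewrite -[leRHS]mulr1 ler_wpM2l.
move=> v; have [v0|v0] := eqVneq (sqnorm v) 0.
  rewrite v0 mulr0 /sqnorm big1// => i _; rewrite big1 ?Normc.normc0 ?expr0n//.
  by move=> j _; rewrite (sqnorm_eq0 v0) mulr0.
have {}v0 : 0 < sqnorm v by rewrite lt_neqAle eq_sym v0 sqnorm_ge0.
set s := Num.sqrt (sqnorm v).
have s0 : 0 < s by rewrite sqrtr_gt0.
have s2 : sqnorm v = s ^+ 2 by rewrite sqr_sqrtr// ltW.
pose w : 'cV[C]_n := \col_i ((s^-1)%:C%C * v i).
have : l2norm (A *m w) <= opnorm A.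
  apply: ub_le_sup => //; exists w => //=.
  rewrite l2normE (@eq_sqnorm _ _ _ (fun i => (s^-1)%:C%C * v i)); last by move=> i;
    rewrite mxE.
  rewrite sqnormZ modc_real ger0_norm ?invr_ge0 ?(ltW s0)// s2 -exprMn mulVf ?gt_eqF//.
  by rewrite expr1n sqrtr1.
rewrite l2normE sqnorm_mulmx.
rewrite (@eq_sqnorm _ _ _ (fun i => (s^-1)%:C%C * \sum_j A i j * v j)); last first.
  by move=> i; rewrite mulr_sumr; apply: eq_bigr => j _; rewrite mxE mulrCA.
rewrite sqnormZ modc_real sqrtrM ?sqr_ge0// sqrtr_sqr normr_id ger0_norm ?invr_ge0 ?(ltW s0)//.
rewrite mulrC ler_pdivrMr// => h.
set T := sqnorm _ in h *.
rewrite -[T]sqr_sqrtr ?sqnorm_ge0// s2 -exprMn ler_sqr// nnegrE ?sqrtr_ge0//.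
exact: le_trans (sqrtr_ge0 _) h.
Qed.

End OperatorNorm.

Section RectNorm.
Context {R : realType} {Y : topologicalType}.
Local Notation C := R[i].
Local Notation modc := (@Normc.normc R).

(** Extending a family by zero does not change its sum; this is what makes
    [mx_pad] harmless for norms. *)
Lemma sum_insub (p N : nat) (V : nmodType) (f : 'I_p -> V) : (p <= N)%N ->
  \sum_(i < N) (if insub (val i) is Some i' then f i' else 0) = \sum_(i < p) f i.
Proof.
move=> pN; pose g k := if insub k is Some i' then f i' else 0.
rewrite -[LHS]/(\sum_(i < N) g i).
have -> : \sum_(i < p) f i = \sum_(i < p) g i.
  by apply: eq_bigr => i _; rewrite /g valK.
rewrite (big_ord_widen N g pN) [RHS]big_mkcond /=; apply: eq_bigr => i _.
by case: ifP => // ip; rewrite /g insubF.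
Qed.

Lemma mx_padE p q (D : 'M[C0 R Y]_(p, q)) i j y :
  mx_pad D i j y = if insub (val i) is Some i' then
    (if insub (val j) is Some j' then D i' j' y else 0) else 0.
Proof. by rewrite mxE; case: insub => [a|//]; case: insub. Qed.

Lemma sqopnorm_le_pad p q (D : 'M[C0 R Y]_(p, q)) y c : 0 <= c ->
  sqopnorm_le (fun i j => mx_pad D i j y) c <-> sqopnorm_le (fun i j => D i j y) c.
Proof.
have pN : (p <= maxn p q)%N := leq_maxl p q.
have qN : (q <= maxn p q)%N := leq_maxr p q.
move=> c0; split=> h v.
  pose v' (j : 'I_(maxn p q)) := if insub (val j) is Some j' then v j' else 0.
  have -> : sqnorm v = sqnorm v'.
    rewrite /sqnorm -(sum_insub (fun j => modc (v j) ^+ 2) qN); apply: eq_bigr => j _.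
    by rewrite /v'; case: insub => //; rewrite Normc.normc0 expr0n.
  apply: le_trans (h v').
  rewrite /sqnorm -(sum_insub _ pN); apply: ler_sum => i _.
  rewrite le_eqVlt; apply/orP; left; apply/eqP.
  case Ei : (insub (val i)) => [i'|].
    congr (modc _ ^+ 2).
    rewrite -(sum_insub (fun j => D i' j y * v j) qN); apply: eq_bigr => j _.
    by rewrite mx_padE Ei /v'; case: insub => //; rewrite mulr0.
  rewrite big1 ?Normc.normc0 ?expr0n// => j _.
  by rewrite mx_padE Ei mul0r.
pose v' (j : 'I_q) := v (widen_ord qN j).
have v'v : sqnorm v' <= sqnorm v.
  rewrite /sqnorm -(sum_insub (fun j => modc (v' j) ^+ 2) qN); apply: ler_sum => j _.
  case: insubP => [j' _ jj'|_]; last exact: sqr_ge0.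
  by rewrite /v' (_ : widen_ord _ _ = j)//; exact: val_inj.
apply: le_trans (ler_wpM2l c0 v'v); apply: le_trans (h v').
rewrite /sqnorm -[leRHS](sum_insub _ pN); apply: ler_sum => i _.
rewrite le_eqVlt; apply/orP; left; apply/eqP.
case Ei : (insub (val i)) => [i'|].
  congr (modc _ ^+ 2).
  rewrite -(sum_insub (fun j => D i' j y * v' j) qN); apply: eq_bigr => j _.
  rewrite mx_padE Ei; case: insubP => [j' _ jj'|_]; last by rewrite mul0r.
  by rewrite /v' (_ : widen_ord _ _ = j)//; exact: val_inj.
rewrite big1 ?Normc.normc0 ?expr0n// => j _.
by rewrite mx_padE Ei mul0r.
Qed.

Lemma rect_norm_ge0 p q (D : 'M[C0 R Y]_(p, q)) : 0 <= rect_norm D.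
Proof.
by apply: sup_ge0 => _ [y _ <-]; exact: opnorm_ge0.
Qed.

Lemma rect_norm_le p q (D : 'M[C0 R Y]_(p, q)) c : 0 <= c ->
  (forall y, sqopnorm_le (fun i j => D i j y) (c ^+ 2)) -> rect_norm D <= c.
Proof.
move=> c0 h; rewrite /rect_norm /Cstar_norm.
set S := (X in sup X).
have [[x Sx]|S0] := pselect (S !=set0); last first.
  suff -> : S = set0 by rewrite sup0.
  by apply/seteqP; split => // z Sz; apply: S0; exists z.
apply: ge_sup; first by exists x.
move=> _ [y _ <-]; apply: opnorm_le => //.
apply: (@eq_sqopnorm_le _ _ _ (fun i j => mx_pad D i j y)); first by move=> i j;
  rewrite [RHS]mxE.
by apply/sqopnorm_le_pad => //; rewrite sqr_ge0.
Qed.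

(** The supremum of an unbounded set of reals is 0 by convention, so that
    boundedness has to be checked: the entries are bounded functions, and their
    Hilbert-Schmidt norm bounds every [opnorm] uniformly in [y]. *)
Lemma rect_norm_bd p q (D : 'M[C0 R Y]_(p, q)) y :
  sqopnorm_le (fun i j => D i j y) (rect_norm D ^+ 2).
Proof.
have [M M0 hM] : exists2 M : R, 0 <= M &
   forall y, \sum_i \sum_j modc (mx_pad D i j y) ^+ 2 <= M ^+ 2.
  have hb (b : C0 R Y) : {M : R | 0 < M & forall y, modc (b y) <= M}.
    by apply: cid2; have [M M0 hM] := C0_bounded b; exists M.
  pose B b := s2val (hb b).
  have Bge0 (b : C0 R Y) : 0 <= B b by rewrite ltW// /B; case: (hb b).
  have Bge (b : C0 R Y) z : modc (b z) <= B b by rewrite /B; case: (hb b).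
  set T := \sum_i \sum_j (B (mx_pad D i j)) ^+ 2.
  have T0 : 0 <= T by do 2![apply: sumr_ge0 => ? _]; rewrite sqr_ge0.
  exists (Num.sqrt T); first exact: sqrtr_ge0.
  move=> z; rewrite sqr_sqrtr//; do 2![apply: ler_sum => ? _].
  by rewrite ler_sqr ?nnegrE ?modc_ge0.
apply/sqopnorm_le_pad; first by rewrite sqr_ge0.
apply: (@eq_sqopnorm_le _ _ _ (fun i j => map_mx (fun b : C0 R Y => b y) (mx_pad D) i j)).
  by move=> i j; rewrite [LHS]mxE.
apply: sqopnorm_leW (@opnorm_bd _ _ _).
rewrite ler_sqr ?nnegrE ?rect_norm_ge0 ?opnorm_ge0//.
apply: ub_le_sup; last by exists y.
exists M => _ [z _ <-]; apply: opnorm_le => //.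
apply: (@eq_sqopnorm_le _ _ _ (fun i j => mx_pad D i j z)); first by move=> i j;
  rewrite [RHS]mxE.
exact: sqopnorm_leW (hM z) (@sqopnorm_le_HS _ _ _ _).
Qed.

End RectNorm.

(** * Functions vanishing at infinity, and bump functions *)

Section C0Construction.
Context {R : realType}.
Local Notation C := R[i].
Local Notation modc := (@Normc.normc R).

Lemma continuous_real_complex : continuous ((fun r => r%:C%C) : R -> R[i]^o).
Proof.
move=> r; have FF : Filter (nbhs r) by exact: nbhs_filter.
apply/(@cvgrPdist_lt _ R[i]^o) => e e0.
have [er ei] : 0 < complex.Re e /\ e = (complex.Re e)%:C%C.
  by have := RRe_real (gtr0_real e0) => ee; split=> //; move: e0; rewrite -{1}ee ltcR.
near=> s; rewrite -rmorphB /= normr_modc modc_real ei ltcR.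
near: s; exact: (@cvgr_dist_lt _ R^o).
Unshelve. all: by end_near. Qed.

Lemma sqrt_continuousT : continuous (@Num.sqrt R).
Proof. exact: sqrt_continuous. Qed.

Section Domination.
Context {Y : topologicalType}.

Lemma C0_continuous (b : C0 R Y) : continuous (b : Y -> R[i]^o).
Proof. by have /asboolP[] := C0P b. Qed.

Lemma C0_modc_continuous (b : C0 R Y) : continuous (fun y => modc (b y)).
Proof.
move=> y; apply: (@continuous_comp Y R[i]^o R (b : Y -> R[i]^o) modc).
  exact: C0_continuous.
exact: modc_continuous.
Qed.

Lemma is_C0_dominated (f : C0 R Y) (h : Y -> C) (M : R) :
  continuous (h : Y -> R[i]^o) -> (forall y, modc (h y) <= M * modc (f y)) ->
  h \in @is_C0 R Y.
Proof.
move=> hc hM; apply/asboolP; split=> // e e0.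
have /asboolP[_ f0] := C0P f.
have M0 : 0 < `|M| + 1 by rewrite ltr_wpDl.
have [K cK hK] := f0 (e / (`|M| + 1)) (divr_gt0 e0 M0).
exists K => // y /hK; rewrite ltr_pdivlMr// mulrC; apply: le_lt_trans.
apply: le_trans (hM y) _; rewrite ler_wpM2r ?modc_ge0//.
by rewrite (le_trans (ler_norm _))// lerDl.
Qed.

Lemma real_C0 (f : C0 R Y) (h : Y -> R) (M : R) :
  continuous h -> (forall y, `|h y| <= M * modc (f y)) ->
  {b : C0 R Y | forall y, b y = (h y)%:C%C}.
Proof.
move=> hc hM.
have P : (fun y => (h y)%:C%C) \in @is_C0 R Y.
  apply: (@is_C0_dominated f _ M) => y; last by rewrite modc_real.
  apply: (@continuous_comp Y R R[i]^o h (fun r => r%:C%C)); first exact: hc.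
  exact: continuous_real_complex.
by exists (MkC0 P).
Qed.

Hypothesis lY : locally_compact [set: Y].
Hypothesis hY : hausdorff_space Y.

(** Complete regularity separates [y] from the complement of [U] intersected
    with a compact neighbourhood, so the separating function also has compact
    support.  The real function [g] is kept beside its complex version [f]
    because squares, maxima and square roots are taken of it later. *)
Lemma C0_bump (y : Y) (U : set Y) : nbhs y U ->
  exists f : C0 R Y, exists g : Y -> R,
  [/\ continuous g, forall z, f z = (g z)%:C%C, forall z, 0 <= g z <= 1,
      g y = 1 & forall z, ~ U z -> g z = 0].
Proof.
move=> Uy.
have [K yK [cK clK]] := lY I : compact_near (within [set: Y] (nbhs y)).
have {}yK : nbhs y K by move: (yK : nbhs y (fun t => [set: Y] t ->
  K t)); apply: filterS => z; apply.
pose W := (U `&` K)^°.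
have Wy : W y by apply: filterI.
have /(@uniform_separatorP _ R)[h [hc h01 hy hW]] :
    uniform_separator [set y] (~` W).
  apply: (@locally_compact_completely_regular Y R lY hY); last by apply.
  by rewrite closedC; exact: open_interior.
have gW z : ~ W z -> 1 - h z = 0.
  by move=> Wz; rewrite (hW (h z)) ?subrr//; exists z.
have g01 z : 0 <= 1 - h z <= 1.
  have : `[0%R, 1%R]%classic (h z) by apply: h01; exists z.
  by rewrite /= in_itv/=; lra.
have gc : continuous (fun z => 1 - h z).
  by move=> z; apply: cvgB; [exact: cvg_cst|exact: hc].
have P : (fun z => (1 - h z)%:C%C) \in @is_C0 R Y.
  apply/asboolP; split.
    move=> z; apply: (@continuous_comp Y R R[i]^o _ (fun r => r%:C%C)).
      exact: gc.
    exact: continuous_real_complex.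
  move=> e e0; exists K => // z Kz.
  rewrite gW ?Normc.normc0// => /interior_subset[_ ]; exact: Kz.
exists (MkC0 P), (fun z => 1 - h z); split => // [|z Uz].
  by rewrite (hy (h y)) ?subr0//; exists y.
by apply: gW => /interior_subset[].
Qed.

End Domination.
End C0Construction.

Section Localization.
Context {R : realType}.
Local Notation C := R[i].
Local Notation modc := (@Normc.normc R).

Lemma continuous_sum_fun (Y : topologicalType) (I : finType) (P : pred I) (h : I -> Y -> R) :
  (forall i, continuous (h i)) -> continuous (fun z => \sum_(i | P i) h i z).
Proof.
move=> hc; have -> : (fun z => \sum_(i | P i) h i z) = \sum_(i | P i) h i.
  by apply/funext => z; rewrite fct_sumE.
elim/big_ind: _ => [|f g fc gc|i _]; last exact: hc.
  by move=> z; exact: cvg_cst.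
by move=> z; apply: cvgD; [exact: fc|exact: gc].
Qed.

(** From bumps [h i] at [y i] vanishing at the other points, the functions
    [max 0 (h i - sum_(j != i) h j)] have disjoint supports: where one of them is
    positive, [h i] exceeds every other [h j]. *)
Lemma disjoint_bumps (Y : topologicalType) (lY : locally_compact [set: Y])
    (hY : hausdorff_space Y) (I : finType) (y : I -> Y) : injective y ->
  exists b : I -> C0 R Y, exists g : I -> Y -> R,
  [/\ forall i z, b i z = (g i z)%:C%C, forall i z, 0 <= g i z <= 1,
      forall i j, g i (y j) = (i == j)%:R &
      forall z i j, i != j -> g i z * g j z = 0].
Proof.
move=> yI.
have /choice[f Hf] i : exists f : C0 R Y * (Y -> R),
    [/\ continuous f.2, forall z, f.1 z = (f.2 z)%:C%C, forall z, 0 <= f.2 z <= 1,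
      f.2 (y i) = 1 & forall j, j != i -> f.2 (y j) = 0].
  have [|f [h [hc fh h01 hy hU]]] := @C0_bump R Y lY hY (y i) (~` (y @` [set j | j != i])).
    apply: open_nbhs_nbhs; split; last first.
      by move=> [j /= /eqP ji /yI]; exact: ji.
    rewrite openC; have /accessible_finite_set_closed := hausdorff_accessible hY.
    by apply; apply: finite_image; exact: finite_finset.
  exists (f, h); split => //= j ji; apply: hU => /(_ _); apply.
  by exists j.
pose h i := (f i).2.
have h0 i z : 0 <= h i z by have [_ _ /(_ z)/andP[]] := Hf i.
pose s i z := \sum_(j | j != i) h j z.
have s0 i z : 0 <= s i z by exact: sumr_ge0.
pose g i z := Num.max 0 (h i z - s i z).
have g0 i z : 0 <= g i z by rewrite le_max lexx.
have gh i z : g i z <= h i z by rewrite ge_max h0/= lerBlDr lerDl.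
have gc i : continuous (g i).
  move=> z; apply: (@continuous_max R Y (fun _ => 0) (fun z => h i z - s i z)).
    exact: cvg_cst.
  apply: cvgB; first by have [+ _ _ _ _] := Hf i; exact.
  by apply: continuous_sum_fun => j; have [] := Hf j.
have /choice[b Hb] i : exists b : C0 R Y, forall z, b z = (g i z)%:C%C.
  have [|b Hb] := @real_C0 R Y (f i).1 (g i) 1 (gc i); last by exists b.
  move=> z; have [_ -> _ _ _] := Hf i.
  by rewrite modc_real mul1r -/(h i) (ger0_norm (g0 _ _)) (ger0_norm (h0 _ _)); exact: gh.
exists b, g; split=> //.
- move=> i z; rewrite g0/= (le_trans (gh i z))//.
  by have [_ _ /(_ z)/andP[]] := Hf i.
- move=> i j; have [->|ij] := eqVneq i j.
    rewrite /g /s big1 => [|k kj]; last first.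
      by have [_ _ _ _ + ] := Hf k; apply; rewrite eq_sym.
    by rewrite subr0 /h; have [_ _ _ -> _] := Hf j; rewrite max_r.
  apply/eqP; rewrite eq_le g0 andbT (le_trans (gh i (y j)))//.
  by have [_ _ _ _ hz] := Hf i; rewrite /h hz// eq_sym.
- move=> z i j ij; apply/eqP; rewrite mulf_eq0; apply/orP.
  have hs k l : k != l -> h l z <= s k z.
    by move=> kl; rewrite /s (bigD1 l) 1?eq_sym//= lerDl sumr_ge0.
  rewrite /g; have [hij|/ltW hij] := leP (h i z) (h j z); [left|right].
    by apply/eqP/max_l; rewrite subr_le0 (le_trans hij)// hs.
  by apply/eqP/max_l; rewrite subr_le0 (le_trans hij)// hs// eq_sym.
Qed.

(** The points where [d <= |h|] form a compact set, whose image under [mu] is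
    compact, hence closed, and avoids [x]. *)
Lemma small_near_fibre (X Y : topologicalType) (hX : hausdorff_space X)
    (mu : continuousType Y X) (h : C0 R Y) (x : X) (d : R) :
  0 < d -> (forall y, mu y = x -> h y = 0) ->
  nbhs x [set x' | forall y, mu y = x' -> modc (h y) < d].
Proof.
move=> d0 hx; have /asboolP[_ /(_ d d0)[K cK hK]] := C0P h.
pose A := K `&` (fun y => modc (h y)) @^-1` [set r | d <= r].
have cA : compact A.
  apply: compact_closedI => //; apply: closed_comp; last exact: closed_ge.
  by move=> y _; exact: C0_modc_continuous.
have cmuA : closed (mu @` A).
  apply: compact_closed => //; apply: continuous_compact => //.
  by apply: continuous_subspaceT => y; exact: cts_fun.
have : nbhs x (~` (mu @` A)).
  apply: open_nbhs_nbhs; split; first by rewrite openC.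
  move=> [y [_ /= dy] yx]; move: dy; rewrite hx// Normc.normc0.
  by rewrite leNgt d0.
apply: filterS => x' Ax' y yx'; have [Ky|/hK//] := pselect (K y).
rewrite ltNge; apply/negP => dy; apply: Ax'; exists y => //.
Qed.

(** The functions [rho s] are bumps divided by the square root of
    [max (1/4) (sum of their squares)], and each vanishes outside a chosen
    neighbourhood [V (c s)].  The squares are what sums to 1, since in a tensor
    product each of the two legs receives one factor [rho s]. *)
Lemma partition_of_unity (X : topologicalType) (lX : locally_compact [set: X])
    (hX : hausdorff_space X) (K : set X) (V : X -> set X) :
  compact K -> (forall x, nbhs x (V x)) ->
  exists (S : finType) (c : S -> X) (b : S -> C0 R X) (rho : S -> X -> R),
  [/\ forall s x, b s x = (rho s x)%:C%C,
      forall s x, rho s x != 0 -> V (c s) x,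
      forall x, \sum_s rho s x ^+ 2 <= 1 &
      forall x, K x -> \sum_s rho s x ^+ 2 = 1].
Proof.
move=> cK hV.
have /choice[f Hf] x : exists f : C0 R X * (X -> R),
    [/\ continuous f.2, forall z, f.1 z = (f.2 z)%:C%C, forall z, 0 <= f.2 z <= 1,
      f.2 x = 1 & forall z, ~ V x z -> f.2 z = 0].
  by have [f [h H]] := C0_bump (R := R) lX hX (hV x); exists (f, h).
pose h x := (f x).2.
have hc x : continuous (h x) by have [] := Hf x.
pose O x := [set z | 1/2 < h x z].
have Oo x : open (O x).
  apply: (@open_comp _ _ (h x) [set r | 1/2 < r]); last exact: open_gt.
  by move=> z _; exact: hc.
have [D KD] : exists D : {fset X}, forall z, K z -> exists2 x, x \in D & O x z.
  have [[x0 _]|X0] := pselect (exists x : X, True); last first.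
    by exists fset0 => z; case: X0; exists z.
  (* [compact_cover] is about pointed spaces *)
  pose pX : ptopologicalType := HB.pack_for ptopologicalType X (isPointed.Build X x0).
  have cov : K `<=` cover [set: X] O.
    move=> z _; exists z => //=; rewrite /O /= /h.
    by have [_ _ _ -> _] := Hf z; lra.
  move: (cK); rewrite -[compact K]/(@compact pX K) (@compact_cover pX).
  move=> /(_ X setT O (fun i _ => Oo i) cov)[D _ HD]; exists D => z /HD[x /= xD Oxz].
  by exists x.
pose S : finType := D.
pose G x := \sum_(s : S) h (val s) x ^+ 2.
have G0 x : 0 <= G x by apply: sumr_ge0 => s _; exact: sqr_ge0.
have Gc : continuous G.
  apply: continuous_sum_fun => s z; rewrite /= (_ : (fun _ => _) = h (val s) \* h (val s)).
    by apply: cvgM; exact: hc.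
  by apply/funext => w /=; rewrite expr2.
have GK x : K x -> 1/4 <= G x.
  move=> /KD[z zD Oxz]; rewrite /G (bigD1 [` zD]%fset)//=.
  apply: le_trans (_ : h z x ^+ 2 <= _); last first.
    by rewrite lerDl sumr_ge0// => s _; exact: sqr_ge0.
  rewrite (_ : 1/4 = (1/2)^+2); last by field.
  by have : 1/2 < h z x by []; nra.
pose m x := Num.max (1/4) (G x).
have m0 x : 1/4 <= m x by rewrite le_max lexx.
have mp x : 0 < m x by rewrite (lt_le_trans _ (m0 x)).
have mc : continuous m.
  move=> z; apply: (@continuous_max R X (fun _ => 1/4) G); [exact: cvg_cst|exact: Gc].
pose q x := Num.sqrt (m x)^-1.
have q2 x : q x ^+ 2 = (m x)^-1 by rewrite sqr_sqrtr// invr_ge0 ltW.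
have qc : continuous q.
  move=> z; apply: (@continuous_comp _ _ _ (fun x => (m x)^-1) (@Num.sqrt R)).
    by apply: cvgV; [rewrite gt_eqF|exact: mc].
  exact: sqrt_continuousT.
have q_le x : `|q x| <= 2.
  rewrite ger0_norm ?sqrtr_ge0// -(@ler_sqr _ _ 2) ?nnegrE ?sqrtr_ge0// q2.
  by rewrite -[(m x)^-1]mul1r ler_pdivrMr//; have := m0 x; lra.
pose rho (s : S) x := h (val s) x * q x.
have /choice[b Hb] (s : S) : exists b : C0 R X, forall z, b z = (rho s z)%:C%C.
  have [||b Hb] := @real_C0 R X (f (val s)).1 (rho s) 2; last by exists b.
    by move=> z; apply: cvgM; [exact: hc|exact: qc].
  move=> z; have [_ -> _ _ _] := Hf (val s).
  by rewrite modc_real /rho normrM mulrC ler_wpM2r.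
have sumE x : \sum_s rho s x ^+ 2 = G x / m x.
  by rewrite /G mulr_suml; apply: eq_bigr => s _; rewrite exprMn q2.
exists S, (fun s => val s), b, rho; split => //.
- move=> s x; apply: contra_neqP => nV; rewrite /rho /h.
  by have [_ _ _ _ ->] := Hf (val s); rewrite ?mul0r.
- by move=> x; rewrite sumE ler_pdivrMr// mul1r le_max lexx orbT.
- move=> x /GK Gx; rewrite sumE /m max_r// divff// gt_eqF//.
  by rewrite (lt_le_trans _ Gx).
Qed.

End Localization.

(** * The balanced tensor product *)

Section TensorAlgebra.
Context {R : realType} {X Y1 Y2 : topologicalType}.
Context {mu1 : continuousType Y1 X} {mu2 : continuousType Y2 X}.
Local Notation tens := (tens (C0_act (R := R) mu1) (C0_act (R := R) mu2)).
Local Notation T := (C0_tensor R mu1 mu2).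

Lemma C0_addE (Y : topologicalType) (f g : C0 R Y) y : (f + g) y = f y + g y.
Proof. by []. Qed.

Lemma C0_scaleE (Y : topologicalType) c (f : C0 R Y) y : (c *: f) y = c * f y.
Proof. by []. Qed.

Lemma C0_subE (Y : topologicalType) (f g : C0 R Y) y : (f - g) y = f y - g y.
Proof. by []. Qed.

Lemma C0_0E (Y : topologicalType) y : (0 : C0 R Y) y = 0.
Proof. by []. Qed.

Lemma C0_sumE (Y : topologicalType) (I : finType) (P : pred I) (f : I -> C0 R Y) y :
  (\sum_(i | P i) f i) y = \sum_(i | P i) f i y.
Proof. exact: (big_morph (fun g : C0 R Y => g y)). Qed.

Lemma C0_eqP (Y : topologicalType) (f g : C0 R Y) : (forall y, f y = g y) -> f = g.
Proof. by move=> fg; apply: val_inj; apply/funext. Qed.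

Lemma C0_actE (Y : topologicalType) (mu : continuousType Y X) (a : C0 R X) (f : C0 R Y) y :
  C0_act mu a f y = a (mu y) * f y.
Proof. by []. Qed.

Lemma tensDl f f' g : tens (f + f') g = tens f g + tens f' g.
Proof. exact: (balanced_addl (tens_balanced _ _)). Qed.

Lemma tensDr f g g' : tens f (g + g') = tens f g + tens f g'.
Proof. exact: (balanced_addr (tens_balanced _ _)). Qed.

Lemma tensZl c f g : tens (c *: f) g = c *: tens f g.
Proof. exact: (balanced_scalel (tens_balanced _ _)). Qed.

Lemma tensZr c f g : tens f (c *: g) = c *: tens f g.
Proof. exact: (balanced_scaler (tens_balanced _ _)). Qed.

Lemma tens_act a f g : tens (C0_act mu1 a f) g = tens f (C0_act mu2 a g).
Proof. exact: (balanced_act (tens_balanced _ _)). Qed.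

Lemma tens0l g : tens 0 g = 0 :> T.
Proof. by rewrite -(scale0r 0) tensZl scale0r. Qed.

Lemma tens0r f : tens f 0 = 0 :> T.
Proof. by rewrite -(scale0r 0) tensZr scale0r. Qed.

Lemma tens_suml (I : finType) (f : I -> C0 R Y1) g :
  tens (\sum_i f i) g = \sum_i tens (f i) g.
Proof. exact: (big_morph (tens^~ g) (fun x y => tensDl x y g) (tens0l g)). Qed.

Lemma tens_sumr (I : finType) f (g : I -> C0 R Y2) :
  tens f (\sum_i g i) = \sum_i tens f (g i).
Proof. exact: (big_morph (tens f) (tensDr f) (tens0r f)). Qed.

End TensorAlgebra.

(** * Weighted Haagerup factorizations *)

Section Factorization.
Context {R : realType} {X Y1 Y2 : topologicalType}.
Variables (mu1 : continuousType Y1 X) (mu2 : continuousType Y2 X).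
Local Notation tens := (tens (C0_act (R := R) mu1) (C0_act (R := R) mu2)).
Local Notation T := (C0_tensor R mu1 mu2).
Local Notation modc := (@Normc.normc R).

(** A factorization of [F] whose two factors have squared norms at most [w] at
    the points over [x].  For the constant weight [t] this says, up to an
    arbitrarily small loss, that the Haagerup seminorm of [F] is at most [t]
    ([haagerup_norm_le], [haagerup_norm_factor]); non-constant
    weights keep track of localized factorizations, and juxtaposition of
    factorizations adds weights. *)
Definition haagerup_factor n (F : 'M[T]_n) (w : X -> R) : Prop :=
  exists (I : finType) (D : 'I_n -> I -> C0 R Y1) (E : I -> 'I_n -> C0 R Y2),
  [/\ forall i j, F i j = \sum_k tens (D i k) (E k j),
      forall y, sqopnorm_le (fun k i => D i k y) (w (mu1 y)) &
      forall z, sqopnorm_le (fun k j => E k j z) (w (mu2 z))].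

Lemma haagerup_factorW n (F : 'M[T]_n) w w' : (forall x, w x <= w' x) ->
  haagerup_factor F w -> haagerup_factor F w'.
Proof.
move=> ww [I [D [E [FDE hD hE]]]]; exists I, D, E; split=> //.
- by move=> y; exact: sqopnorm_leW (ww _) (hD y).
- by move=> z; exact: sqopnorm_leW (ww _) (hE z).
Qed.

Lemma sqopnorm_le_sum (I I' J : finType) (a : I -> J -> R[i]) (b : I' -> J -> R[i]) c d :
  sqopnorm_le a c -> sqopnorm_le b d ->
  sqopnorm_le (fun (k : I + I') j => match k with inl k => a k j | inr k => b k j end) (c + d).
Proof. by move=> ha hb v; rewrite /sqnorm big_sumType /= mulrDl; apply: lerD;
  [exact: ha|exact: hb]. Qed.

Lemma haagerup_factorD n (F G : 'M[T]_n) w w' :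
  haagerup_factor F w -> haagerup_factor G w' -> haagerup_factor (F + G) (fun x => w x + w' x).
Proof.
move=> [I [D [E [FDE hD hE]]]] [I' [D' [E' [GDE hD' hE']]]].
exists (I + I')%type,
  (fun i k => match k with inl k => D i k | inr k => D' i k end),
  (fun k j => match k with inl k => E k j | inr k => E' k j end); split.
- by move=> i j; rewrite mxE FDE GDE big_sumType.
- move=> y; apply: eq_sqopnorm_le (sqopnorm_le_sum (hD y) (hD' y)).
  by case.
- move=> z; apply: eq_sqopnorm_le (sqopnorm_le_sum (hE z) (hE' z)).
  by case.
Qed.

Lemma haagerup_factor0 n : haagerup_factor (0 : 'M[T]_n) (fun _ => 0).
Proof.
exists void, (fun _ _ => 0), (fun _ _ => 0); split.
- by move=> i j; rewrite mxE big_pred0 //; case.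
- by move=> y v; rewrite mul0r /sqnorm big_pred0//; case.
- by move=> y v; rewrite mul0r /sqnorm big_pred0//; case.
Qed.

Lemma haagerup_factor_sum (S : finType) n (F : S -> 'M[T]_n) (w : S -> X -> R) :
  (forall s, haagerup_factor (F s) (w s)) ->
    haagerup_factor (\sum_s F s) (fun x => \sum_s w s x).
Proof.
move=> h; suff : haagerup_factor (\sum_s F s) (\sum_s w s).
  by apply: haagerup_factorW => x; rewrite fct_sumE.
elim/big_ind2: _ => [|F1 w1 F2 w2 h1 h2|s _]; last exact: h; first exact: haagerup_factor0.
exact: (haagerup_factorD h1 h2).
Qed.

(** Scaling one factor by [s] and the other by [s^-1] trades bounds [a^2 w] and
    [b^2 w] for a common bound [a b w]. *)
Lemma haagerup_factor_balance (I : finType) n (F : 'M[T]_n) (w : X -> R) (a b : R)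
    (D : 'I_n -> I -> C0 R Y1) (E : I -> 'I_n -> C0 R Y2) : 0 < a -> 0 < b ->
  (forall i j, F i j = \sum_k tens (D i k) (E k j)) ->
  (forall y, sqopnorm_le (fun k i => D i k y) (a ^+ 2 * w (mu1 y))) ->
  (forall z, sqopnorm_le (fun k j => E k j z) (b ^+ 2 * w (mu2 z))) ->
  haagerup_factor F (fun x => a * b * w x).
Proof.
move=> a0 b0 FDE hD hE.
pose s := Num.sqrt (b / a).
have s0 : 0 < s by rewrite sqrtr_gt0 divr_gt0.
have s2 : s ^+ 2 = b / a by rewrite sqr_sqrtr// ltW// divr_gt0.
exists I, (fun i k => s%:C%C *: D i k), (fun k j => (s^-1)%:C%C *: E k j); split.
- move=> i j; rewrite FDE; apply: eq_bigr => k _.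
  rewrite tensZl tensZr scalerA -rmorphM /= divff ?gt_eqF//.
  by rewrite scale1r.
- move=> y; apply: sqopnorm_leW (sqopnorm_le_scale (s%:C%C) (hD y)).
  rewrite modc_real ger0_norm ?(ltW s0)// s2 le_eqVlt; apply/orP; left; apply/eqP.
  by field; rewrite gt_eqF.
- move=> z; apply: sqopnorm_leW (sqopnorm_le_scale ((s^-1)%:C%C) (hE z)).
  rewrite modc_real ger0_norm ?invr_ge0 ?(ltW s0)// exprVn s2 le_eqVlt.
  by apply/orP; left; apply/eqP; field; rewrite !gt_eqF.
Qed.

Lemma sqopnorm_le_enum_row (I J : finType) (a : I -> J -> R[i]) c :
  sqopnorm_le a c -> sqopnorm_le (fun (k : 'I_#|I|) j => a (enum_val k) j) c.
Proof.
move=> h v; apply: le_trans (h v).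
rewrite /sqnorm [leRHS](eq_bigl (fun k => k \in I))//.
by rewrite [leRHS]big_enum_val.
Qed.

Lemma haagerup_norm_le n (F : 'M[T]_n) t : 0 <= t -> haagerup_factor F (fun _ => t) ->
  (haagerup_norm F <= t%:E)%E.
Proof.
move=> t0 [I [D [E [FDE hD hE]]]].
pose D' := \matrix_(i < n, k < #|I|) D i (enum_val k).
pose E' := \matrix_(k < #|I|, j < n) E (enum_val k) j.
apply: (@le_trans _ _ (rect_norm D' * rect_norm E')%:E).
  apply: ereal_inf_lbound; exists #|I|, D', E'; split=> //.
  apply/matrixP => i j; rewrite mxE FDE (eq_bigl (fun k => k \in I))//.
  by rewrite big_enum_val; apply: eq_bigr => k _; rewrite !mxE.
rewrite lee_fin -[leRHS]sqr_sqrtr// expr2.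
apply: ler_pM; rewrite ?rect_norm_ge0//.
  apply: rect_norm_le => [|y]; rewrite ?sqrtr_ge0// sqr_sqrtr//.
  apply: (@eq_sqopnorm_le _ _ _ (fun i k => D i (enum_val k) y)) => [i j|].
    by rewrite mxE.
  exact: (sqopnorm_le_tr t0 (sqopnorm_le_enum_row (hD y))).
apply: rect_norm_le => [|y]; rewrite ?sqrtr_ge0// sqr_sqrtr//.
apply: (@eq_sqopnorm_le _ _ _ (fun k j => E (enum_val k) j y)) => [i j|].
  by rewrite mxE.
exact: (sqopnorm_le_enum_row (hE y)).
Qed.

(** A factorization nearly attaining the infimum is balanced.  Adding a small
    [e] to both norms avoids dividing by zero when one factor vanishes. *)
Lemma haagerup_norm_factor n (F : 'M[T]_n) c t : (haagerup_norm F <= c%:E)%E -> c < t ->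
  haagerup_factor F (fun _ => t).
Proof.
move=> Fc ct.
have /ereal_inf_lt[_ [m [D [E [FDE ->]]]]] : (haagerup_norm F < t%:E)%E.
  by rewrite (le_lt_trans Fc)// lte_fin.
rewrite lte_fin => DEt.
set p := rect_norm D in DEt *; set q := rect_norm E in DEt *.
have p0 : 0 <= p := rect_norm_ge0 D; have q0 : 0 <= q := rect_norm_ge0 E.
have [e e0 he] : exists2 e : R, 0 < e & (p + e) * (q + e) <= t.
  exists (Num.min 1 ((t - p * q) / (p + q + 1))).
    by rewrite lt_min ltr01 divr_gt0 ?subr_gt0// ltr_wpDl// addr_ge0.
  set e := Num.min _ _.
  have e1 : e <= 1 by rewrite ge_min lexx.
  have e0 : 0 < e by rewrite lt_min ltr01 divr_gt0 ?subr_gt0// ltr_wpDl// addr_ge0.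
  have : e <= (t - p * q) / (p + q + 1) by rewrite ge_min lexx orbT.
  rewrite ler_pdivlMr; last by rewrite ltr_wpDl// addr_ge0.
  nra.
have pe : 0 < p + e by rewrite ltr_wpDl.
have qe : 0 < q + e by rewrite ltr_wpDl.
apply: (@haagerup_factorW _ _ (fun x => (p + e) * (q + e) * 1)); first by rewrite mulr1.
apply: (@haagerup_factor_balance _ _ _ (fun=> 1) _ _ (fun i k => D i k) (fun k j =>
  E k j)) => //.
- by move=> i j; rewrite FDE mxE.
- move=> y; rewrite mulr1; apply: sqopnorm_le_tr; first exact: sqr_ge0.
  apply: sqopnorm_leW (@rect_norm_bd _ _ _ _ D y).
  by rewrite ler_sqr ?nnegrE// ?lerDl ?(ltW e0)// (ltW pe).
- move=> y; rewrite mulr1; apply: sqopnorm_leW (@rect_norm_bd _ _ _ _ E y).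
  by rewrite ler_sqr ?nnegrE// ?lerDl ?(ltW e0)// (ltW qe).
Qed.

(** An element of the form [sum_l P_l (x) b_l], with matrices [P_l] over the
    first algebra and elements [b_l] of the second, is the product of the row of
    the [P_l] with the column of the [b_l 1]. *)
Lemma haagerup_factor_columns (L : finType) n (G : 'M[T]_n) (w : X -> R) (a c : R)
    (P : L -> 'I_n -> 'I_n -> C0 R Y1) (b : L -> C0 R Y2) : 0 < a -> 0 < c ->
  (forall i j, G i j = \sum_l tens (P l i j) (b l)) ->
  (forall y, sqopnorm_le (fun (k : L * 'I_n) i => P k.1 i k.2 y) (a ^+ 2 * w (mu1 y))) ->
  (forall z, sqnorm (fun l => b l z) <= c ^+ 2 * w (mu2 z)) ->
  haagerup_factor G (fun x => a * c * w x).
Proof.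
move=> a0 c0 GE hP hb.
apply: (@haagerup_factor_balance (L * 'I_n)%type _ _ w _ _ (fun i k => P k.1 i k.2)
   (fun k j => if k.2 == j then b k.1 else 0)) => //.
- move=> i j; rewrite GE -(pair_bigA _ (fun l k =>
  tens (P l i k) (if k == j then b l else 0))) /=.
  apply: eq_bigr => l _; rewrite (bigD1 j)//= eqxx big1 ?addr0// => k /negPf->.
  by rewrite tens0r.
- move=> z v; apply: (@le_trans _ _ (sqnorm (fun l => b l z) * sqnorm v)); last first.
    by rewrite ler_wpM2r ?sqnorm_ge0.
  rewrite /sqnorm big_distrlr /= pair_bigA /= le_eqVlt; apply/orP; left; apply/eqP.
  apply: eq_bigr => -[l k] _ /=; rewrite -exprMn -modcM; congr (modc _ ^+ 2).
  rewrite (bigD1 k)//= eqxx big1 ?addr0// => j; rewrite eq_sym => /negPf->.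
  by rewrite mul0r.
Qed.

End Factorization.

(** * The upper bound near one point *)

Section UpperBound.
Context {R : realType}.
Local Notation modc := (@Normc.normc R).

Lemma at_most_one (I : finType) (g : I -> R) :
  (forall i j, i != j -> g i * g j = 0) ->
  (forall i, g i = 0) \/ exists i0, forall i, i != i0 -> g i = 0.
Proof.
move=> h; have [[i0 gi0]|h0] := pselect (exists i, g i != 0).
  right; exists i0 => i /h /eqP; rewrite mulf_eq0 (negPf gi0) orbF.
  by move/eqP.
by left=> i; apply: contrapT => /eqP gi; apply: h0; exists i.
Qed.

Lemma sum_sqr_disjoint (I : finType) (g : I -> R) :
  (forall i, 0 <= g i <= 1) -> (forall i j, i != j -> g i * g j = 0) ->
  \sum_i g i ^+ 2 <= 1.
Proof.
move=> g01 /at_most_one[g0|[i0 g0]].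
  by rewrite big1// => i _; rewrite g0 expr0n.
rewrite (bigD1 i0)//= big1 ?addr0 => [|i /g0->]; last by rewrite expr0n.
by have /andP[? ?] := g01 i0; rewrite expr_le1.
Qed.

Lemma sqnorm_real (I : finType) (g : I -> R) :
  sqnorm (fun i => (g i)%:C%C) = \sum_i g i ^+ 2.
Proof. by apply: eq_bigr => i _; rewrite modc_real real_normK// num_real. Qed.

Section Crude.
Context {X Y Z : topologicalType}.
Variables (nu : continuousType Z X) (mu : continuousType Y X).
Local Notation tens := (tens (C0_act (R := R) nu) (C0_act (R := R) mu)).
Local Notation T := (C0_tensor R nu mu).

(** The square root bounds the Hilbert-Schmidt norm of a matrix with [k n^3]
    entries of square at most [M], and the second factor the norm of a column of
    [k n] entries at most 1; the added 1s keep both positive. *)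
Definition crude_const (n k : nat) (M : R) : R :=
  Num.sqrt (k%:R * n%:R ^+ 3 * M + 1) * (k%:R * n%:R + 1).

Lemma crude_const_gt0 n k M : 0 <= M -> 0 < crude_const n k M.
Proof.
by move=> M0; apply: mulr_gt0; rewrite ?sqrtr_gt0 ltr_wpDl// !mulr_ge0// exprn_ge0.
Qed.

(** A bound from the size of the entries alone, linear in the size [d] of those
    of [h]; it is used only for error terms. *)
Lemma haagerup_factor_crude (I : finType) n (G : 'M[T]_n) (w : X -> R) (M d : R)
    (E : I -> 'I_n -> C0 R Z) (h : 'I_n -> I -> C0 R Y) :
  0 <= M -> 0 < d -> (forall x, 0 <= w x) ->
  (forall i j, G i j = \sum_k tens (E k j) (h i k)) ->
  (forall k j z, modc (E k j z) ^+ 2 <= M * w (nu z)) ->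
  (forall i k y, modc (h i k y) ^+ 2 <= d ^+ 2 * w (mu y)) ->
  haagerup_factor G (fun x => crude_const n #|I| M * d * w x).
Proof.
move=> M0 d0 w0 GE hE hh.
set A := #|I|%:R * n%:R ^+ 3 * M + 1; set B : R := #|I|%:R * n%:R + 1.
have A0 : 0 < A by rewrite ltr_wpDl// !mulr_ge0// exprn_ge0.
have B0 : 0 < B by rewrite ltr_wpDl// mulr_ge0.
have -> : crude_const n #|I| M * d = Num.sqrt A * (B * d) by rewrite mulrA.
apply: (@haagerup_factor_columns _ _ _ _ _ _ (I * 'I_n)%type _ _ w _ _
   (fun l i j => if i == l.2 then E l.1 j else 0) (fun l => h l.2 l.1)).
- by rewrite sqrtr_gt0.
- by rewrite mulr_gt0.
- move=> i j; rewrite GE -(pair_bigA _ (fun k i' =>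
  tens (if i == i' then E k j else 0) (h i' k))) /=.
  apply: eq_bigr => k _; rewrite (bigD1 i)//= eqxx big1 ?addr0// => i'.
  by rewrite eq_sym => /negPf->; rewrite tens0l.
- move=> z; apply: sqopnorm_leW (@sqopnorm_le_HS _ _ _ _).
  apply: (@le_trans _ _ (\sum_(a : I * 'I_n * 'I_n) \sum_(i < n) M * w (nu z))).
    apply: ler_sum => -[[k i'] j] _; apply: ler_sum => i _ /=.
    by case: ifP => _; rewrite ?hE// C0_0E Normc.normc0 expr0n mulr_ge0.
  rewrite !sumr_const !card_prod !card_ord -!mulrnA sqr_sqrtr ?(ltW A0)//.
  rewrite -mulr_natr !natrM.
  have -> : M * w (nu z) * (n%:R * (#|I|%:R * n%:R * n%:R)) =
     (#|I|%:R * n%:R ^+ 3 * M) * w (nu z) by ring.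
  by rewrite ler_wpM2r// lerDl.
- move=> y; apply: (@le_trans _ _ (\sum_(l : I * 'I_n) d ^+ 2 * w (mu y))).
    by apply: ler_sum => -[k i] _; exact: hh.
  rewrite sumr_const card_prod card_ord -mulr_natr natrM exprMn.
  rewrite mulrC mulrA ler_wpM2r// ler_wpM2r ?sqr_ge0//.
  have : 0 <= #|I|%:R * n%:R :> R by rewrite mulr_ge0.
  by rewrite /B; nra.
Qed.

End Crude.

(** Cardinality is bounded through an enumeration because the points [y l] index
    the bumps and the blocks of the local factorization. *)
Definition fibre_le (X Y : topologicalType) (mu : Y -> X) (x : X) (S : R) : Prop :=
  exists p (y : 'I_p -> Y), [/\ injective y, forall y', mu y' = x -> exists l, y' = y l &
    p%:R <= S].

Section Local.
Context {X Y Z : topologicalType}.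
Variables (hX : hausdorff_space X) (lY : locally_compact [set: Y])
  (hY : hausdorff_space Y).
Variables (nu : continuousType Z X) (mu : continuousType Y X).
Local Notation tens := (tens (C0_act (R := R) nu) (C0_act (R := R) mu)).
Local Notation T := (C0_tensor R nu mu).

(** With [h = D - sum_l D(y_l) beta_l], which vanishes on the fibre over [x0],
    the flip of [rho^2 D odot E] splits as [G1 + G2].  In [G1] the scalars
    [D(y_l)] have been moved to [E]; the row of the [D(y_l) E] has squared norm at
    most [p t^2 <= S t^2].  In [G2] the factor [h] is small on the support of
    [rho]. *)
Lemma local_flip n (I : finType) (D : 'I_n -> I -> C0 R Y) (E : I -> 'I_n -> C0 R Z)
    (t S e : R) (x0 : X) : 0 < t -> 0 < S -> 0 < e ->
  (forall y, sqopnorm_le (fun k i => D i k y) t) ->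
    (forall z, sqopnorm_le (fun k j => E k j z) t) ->
  fibre_le mu x0 S ->
  exists2 V : set X, nbhs x0 V & forall (b : C0 R X) (rho : X -> R),
    (forall x, b x = (rho x)%:C%C) -> (forall x, rho x != 0 -> V x) ->
    haagerup_factor (\matrix_(i, j) \sum_k tens (E k j) (C0_act mu b (C0_act mu b (D i k))) : 'M[T]_n)
      (fun x => (Num.sqrt S * t + e) * rho x ^+ 2).
Proof.
move=> t0 S0 e0 hD hE [p [y [yI yfib pS]]].
have [beta [g [bg g01 gy gd]]] := @disjoint_bumps R Y lY hY _ y yI.
pose h i k : C0 R Y := D i k - \sum_l D i k (y l) *: beta l.
have hfib i k y' : mu y' = x0 -> h i k y' = 0.
  move=> /yfib[l ->]; rewrite /h C0_subE C0_sumE (bigD1 l)// big1 => [|l' ll'].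
    by rewrite C0_scaleE bg gy eqxx mulr1 /= addr0 subrr.
  by rewrite C0_scaleE bg gy (negPf ll') mulr0.
have DE i k : D i k = \sum_l D i k (y l) *: beta l + h i k by rewrite addrC subrK.
pose d := e / crude_const n #|I| t.
have K0 : 0 < crude_const n #|I| t by rewrite crude_const_gt0// ltW.
have d0 : 0 < d by rewrite divr_gt0.
exists [set x | forall i k y', mu y' = x -> modc (h i k y') < d].
  apply: filter_forall => i; apply: filter_forall => k.
  by apply: small_near_fibre => // y'; exact: hfib.
move=> b rho brho rhoV.
pose G1 : 'M[T]_n := \matrix_(i, j)
  \sum_l tens (\sum_k D i k (y l) *: C0_act nu b (E k j)) (C0_act mu b (beta l)).
pose G2 : 'M[T]_n := \matrix_(i, j)
  \sum_k tens (C0_act nu b (E k j)) (C0_act mu b (h i k)).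
have -> : \matrix_(i, j) \sum_k tens (E k j) (C0_act mu b (C0_act mu b (D i k)))
    = G1 + G2.
  apply/matrixP => i j; rewrite !mxE.
  under [X in _ = X + _]eq_bigr do rewrite tens_suml.
  rewrite exchange_big -big_split /=; apply: eq_bigr => k _.
  rewrite -tens_act.
  have -> : C0_act mu b (D i k) =
      \sum_l D i k (y l) *: C0_act mu b (beta l) + C0_act mu b (h i k).
    apply: C0_eqP => y'; rewrite C0_addE C0_sumE !C0_actE {1}(DE i k) C0_addE C0_sumE mulrDr.
    congr (_ + _); rewrite mulr_sumr; apply: eq_bigr => l _.
    by rewrite !C0_scaleE C0_actE mulrCA.
  rewrite tensDr tens_sumr; congr (_ + _); apply: eq_bigr => l _.
  by rewrite tensZr tensZl.
apply: (@haagerup_factorW _ _ _ _ _ _ _ _ (fun x => Num.sqrt S * t * 1 * rho x ^+ 2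
    + crude_const n #|I| t * d * rho x ^+ 2)).
  move=> x; rewrite mulr1 -mulrDl ler_wpM2r ?sqr_ge0// lerD2l /d mulrC divfK//.
  by rewrite gt_eqF.
apply: haagerup_factorD.
- apply: (haagerup_factor_columns (G := G1) (w := fun x => rho x ^+ 2) _ ltr01
    (P := fun l i j => \sum_k D i k (y l) *: C0_act nu b (E k j))
    (b := fun l => C0_act mu b (beta l))).
  + by rewrite mulr_gt0// sqrtr_gt0.
  + by move=> i j; rewrite mxE.
  + move=> z v.
    apply: (@le_trans _ _ (\sum_(l < p) rho (nu z) ^+ 2 * (t ^+ 2 * sqnorm v))).
      rewrite {1}/sqnorm.
      rewrite -(pair_bigA _ (fun l j => modc (\sum_i
         (\sum_k D i k (y l) *: C0_act nu b (E k j)) z * v i) ^+ 2)) /=.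
      apply: ler_sum => l _.
      have hc : sqopnorm_le (fun i j => \sum_k D i k (y l) * E k j z) (t * t).
        apply: sqopnorm_le_comp => //; first exact: ltW.
        exact: (sqopnorm_le_tr (ltW t0) (hD (y l))).
      have := sqopnorm_le_scale ((rho (nu z))%:C%C) (sqopnorm_le_tr (mulr_ge0 (ltW t0) (ltW t0)) hc).
      move=> /(_ v); rewrite modc_real real_normK ?num_real// -expr2 -mulrA.
      apply: le_trans; rewrite le_eqVlt; apply/orP; left; apply/eqP.
      apply: eq_bigr => j _; congr (modc _ ^+ 2); apply: eq_bigr => i _.
      congr (_ * _); rewrite C0_sumE mulr_sumr; apply: eq_bigr => k _.
      by rewrite C0_scaleE C0_actE brho mulrCA.
    rewrite sumr_const card_ord -mulr_natr exprMn sqr_sqrtr ?(ltW S0)//.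
    rewrite [leLHS]mulrC !mulrA ler_wpM2r ?sqnorm_ge0//.
    set r := rho (nu z).
    have -> : p%:R * r * r * t * t = p%:R * (r * t) ^+ 2 by ring.
    have -> : S * t * t * r * r = S * (r * t) ^+ 2 by ring.
    by rewrite ler_wpM2r ?sqr_ge0.
  + move=> y'; rewrite expr1n mul1r.
    rewrite (@eq_sqnorm _ _ _ (fun l => (rho (mu y') * g l y')%:C%C)); last first.
      by move=> l; rewrite C0_actE brho bg -rmorphM.
    rewrite sqnorm_real; under eq_bigr do rewrite exprMn.
    rewrite -mulr_sumr -[leRHS]mulr1 ler_wpM2l ?sqr_ge0//.
    by apply: sum_sqr_disjoint => // i j; exact: gd.
- apply: (haagerup_factor_crude (E := fun k j => C0_act nu b (E k j))
     (h := fun i k => C0_act mu b (h i k))) => //.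
  + exact: ltW.
  + by move=> x; exact: sqr_ge0.
  + by move=> i j; rewrite mxE.
  + move=> k j z; rewrite C0_actE modcM exprMn brho modc_real real_normK ?num_real//.
    rewrite mulrC ler_wpM2r ?sqr_ge0//.
    exact: (sqopnorm_le_entry k j (hE z)).
  + move=> i k y'; rewrite C0_actE modcM exprMn brho modc_real real_normK ?num_real//.
    have [->|/rhoV rV] := eqVneq (rho (mu y')) 0; first by rewrite expr0n mul0r mulr0.
    rewrite mulrC ler_wpM2r ?sqr_ge0// ler_sqr ?nnegrE ?modc_ge0 ?(ltW d0)//.
    by apply/ltW; exact: rV.
Qed.

End Local.
End UpperBound.

(** * The upper bound *)

Section GlobalUpperBound.
Context {R : realType} {X Y1 Y2 : topologicalType}.
Variables (lX : locally_compact [set: X]) (hX : hausdorff_space X).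
Variables (lY1 : locally_compact [set: Y1]) (hY1 : hausdorff_space Y1).
Variables (lY2 : locally_compact [set: Y2]) (hY2 : hausdorff_space Y2).
Local Notation modc := (@Normc.normc R).

Lemma C0_flip_tens (Z1 Z2 : topologicalType) (nu1 : continuousType Z1 X)
    (nu2 : continuousType Z2 X) (f : C0 R Z1) (g : C0 R Z2) :
  C0_flip R nu1 nu2 (tens (C0_act nu1) (C0_act nu2) f g) =
  tens (C0_act nu2) (C0_act nu1) g f.
Proof. exact: tensor_flip_tens. Qed.

Lemma C0_flip_sum (Z1 Z2 : topologicalType) (nu1 : continuousType Z1 X)
    (nu2 : continuousType Z2 X) (I : finType) (t : I -> C0_tensor R nu1 nu2) :
  C0_flip R nu1 nu2 (\sum_k t k) = \sum_k C0_flip R nu1 nu2 (t k).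
Proof.
have lin : linear (C0_flip R nu1 nu2) by exact: tensor_flip_linear.
have D u v : C0_flip R nu1 nu2 (u + v) = C0_flip R nu1 nu2 u + C0_flip R nu1 nu2 v.
  by have := lin 1 u v; rewrite !scale1r.
have Z : C0_flip R nu1 nu2 0 = 0.
  by apply: (addrI (C0_flip R nu1 nu2 0)); rewrite -D !addr0.
exact: (big_morph _ D Z).
Qed.

(** The flip followed by the transpose of matrices preserves the Haagerup
    seminorm, because transposition preserves the norms of the factors; this
    reduces a small fibre in the second space to one in the first. *)
Lemma haagerup_factor_flip (Z1 Z2 : topologicalType) (nu1 : continuousType Z1 X)
    (nu2 : continuousType Z2 X) n (G : 'M[C0_tensor R nu1 nu2]_n) (w : X -> R) :
  haagerup_factor G w -> haagerup_factor (\matrix_(i, j) C0_flip R nu1 nu2 (G j i)) w.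
Proof.
move=> [I [D [E [GE hD hE]]]]; exists I, (fun i k => E k i), (fun k j => D j k).
split=> // i j; rewrite mxE GE C0_flip_sum; apply: eq_bigr => k _.
exact: C0_flip_tens.
Qed.

Variables (mu1 : continuousType Y1 X) (mu2 : continuousType Y2 X).
Local Notation T := (C0_tensor R mu2 mu1).

Lemma flip_upper n (F : 'M[C0_tensor R mu1 mu2]_n) (t S e : R) :
  0 < t -> 0 < S -> 0 < e ->
  (forall x, fibre_le mu1 x S \/ fibre_le mu2 x S) ->
  haagerup_factor F (fun _ => t) ->
  haagerup_factor (map_mx (C0_flip R mu1 mu2) F) (fun _ => Num.sqrt S * t + e).
Proof.
move=> t0 S0 e0 fib [I [D [E [FE hD hE]]]].
have e20 : 0 < e / 2 by rewrite divr_gt0.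
pose ct (b : C0 R X) : 'M[T]_n := \matrix_(i, j)
  \sum_k tens (C0_act mu2) (C0_act mu1) (E k j) (C0_act mu1 b (C0_act mu1 b (D i k))).
have /choice[V HV] (x0 : X) : exists V : set X, nbhs x0 V /\ forall (b : C0 R X) (rho :
  X -> R),
    (forall x, b x = (rho x)%:C%C) -> (forall x, rho x != 0 -> V x) ->
    haagerup_factor (ct b) (fun x => (Num.sqrt S * t + e / 2) * rho x ^+ 2).
  case: (fib x0) => fibx.
    have [V Vx0 HV] := local_flip hX lY1 hY1 mu2 t0 S0 e20 hD hE fibx.
    by exists V.
  have [V Vx0 HV] := local_flip hX lY2 hY2 mu1 (D := fun i k => E k i)
    (E := fun k j => D j k) t0 S0 e20 hE hD fibx.
  exists V; split=> // b rho brho rhoV.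
  have := haagerup_factor_flip (HV b rho brho rhoV).
  congr (haagerup_factor _ _); apply/matrixP => i j; rewrite !mxE C0_flip_sum.
  apply: eq_bigr => k _; rewrite C0_flip_tens.
  by rewrite -!tens_act.
pose K0 := crude_const n #|I| t.
have K00 : 0 < K0 by rewrite crude_const_gt0// ltW.
pose d := e / 2 / K0; have d0 : 0 < d by rewrite divr_gt0.
have [K cK hK] : exists2 K : set X, compact K &
    forall i k y, ~ K (mu1 y) -> modc (D i k y) <= d.
  have /choice[K HK] (ik : 'I_n * I) : exists K : set Y1, compact K /\
      forall y, ~ K y -> modc (D ik.1 ik.2 y) < d.
    have /asboolP[_ /(_ d d0)[K cK hK]] := C0P (D ik.1 ik.2).
    by exists K.
  exists (\big[setU/set0]_(ik : 'I_n * I) (mu1 @` K ik)).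
    apply: bigsetU_compact => ik _; apply: continuous_compact; last by have [] := HK ik.
    by apply: continuous_subspaceT => y; exact: cts_fun.
  move=> i k y nK; apply/ltW; have [_ ] := HK (i, k); apply => Ky; apply: nK.
  by rewrite (bigD1 (i, k))//=; left; exists y.
have [Sg [c [b [rho [brho rhoV rho1 rhoK]]]]] :=
  partition_of_unity (R := R) lX hX cK (fun x => (HV x).1).
pose r i k : C0 R Y1 := D i k - \sum_s C0_act mu1 (b s) (C0_act mu1 (b s) (D i k)).
pose L : 'M[T]_n := \matrix_(i, j) \sum_k tens (C0_act mu2) (C0_act mu1) (E k j) (r i k).
have rE i k y : r i k y = (1 - \sum_s rho s (mu1 y) ^+ 2)%:C%C * D i k y.
  rewrite /r C0_subE C0_sumE rmorphB /= mulrBl mul1r; congr (_ - _).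
  rewrite rmorph_sum mulr_suml; apply: eq_bigr => s _.
  by rewrite brho mulrA rmorphXn expr2.
have hL : haagerup_factor L (fun x => K0 * d * 1).
  apply: (haagerup_factor_crude (E := E) (h := r) (w := fun=> 1)) => //.
  - exact: ltW.
  - by move=> i j; rewrite mxE.
  - by move=> k j z; rewrite mulr1; exact: (sqopnorm_le_entry k j (hE z)).
  - move=> i k y; rewrite mulr1 ler_sqr ?nnegrE ?modc_ge0 ?(ltW d0)//.
    rewrite rE modcM modc_real; have [Ky|nKy] := pselect (K (mu1 y)).
      by rewrite rhoK// subrr normr0 mul0r ltW.
    apply: le_trans (hK i k y nKy); rewrite -[leRHS]mul1r ler_wpM2r ?modc_ge0//.
    have := rho1 (mu1 y); have : 0 <= \sum_s rho s (mu1 y) ^+ 2.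
      by apply: sumr_ge0 => s _; exact: sqr_ge0.
    by move=> ? ?; rewrite ger0_norm; lra.
have -> : map_mx (C0_flip R mu1 mu2) F = \sum_s ct (b s) + L.
  apply/matrixP => i j; rewrite !mxE summxE FE C0_flip_sum.
  under [X in _ = X + _]eq_bigr do rewrite mxE.
  rewrite exchange_big -big_split; apply: eq_bigr => k _ /=.
  rewrite C0_flip_tens -tens_sumr -tensDr; congr (tens _ _ _ _).
  by rewrite /r addrC subrK.
have hc := haagerup_factor_sum (fun s => (HV (c s)).2 (b s) (rho s) (brho s) (rhoV s)).
apply: haagerup_factorW (haagerup_factorD hc hL) => x; rewrite -mulr_sumr mulr1 /d mulrC.
rewrite [K0 * _]mulrC divfK ?gt_eqF//.
have : 0 < Num.sqrt S * t + e / 2 by rewrite ltr_wpDl// mulr_ge0 ?sqrtr_ge0// ltW.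
have := rho1 x; nra.
Qed.

End GlobalUpperBound.

(** * The shift and clock matrices *)

Section Fourier.
Context {R : realType}.
Local Notation C := R[i].
Local Notation modc := (@Normc.normc R).

Lemma prim_root_exists n : (0 < n)%N -> exists z : C, n.-primitive_root z.
Proof.
pose p : {poly C} := 'X^n - 1; have [r Dp] := closed_field_poly_normal p.
move=> n_gt0; rewrite (monicP _) ?monicXnsubC // scale1r in Dp.
have rn1 : all n.-unity_root r.
  by apply/allP => z; rewrite -root_prod_XsubC -Dp.
have sz_r : (n < (size r).+1)%N.
  by rewrite -(size_prod_XsubC r id) -Dp size_XnsubC.
have [|z] := hasP (has_prim_root n_gt0 rn1 _ sz_r); last by exists z.
by rewrite -separable_prod_XsubC -Dp separable_Xn_sub_1 // pnatr_eq0 -lt0n.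
Qed.

(** Parseval's identity for the matrix of powers of a primitive root of unity. *)
Lemma Fourier_matrix n : exists chi : 'I_n.+1 -> 'I_n.+1 -> C,
  (forall j l, modc (chi j l) = 1) /\
  forall q : 'I_n.+1 -> C,
    sqnorm (fun j => \sum_l q l * conjc (chi j l)) = n.+1%:R * sqnorm q.
Proof.
have [z zP] := prim_root_exists (ltn0Sn n).
have z1 : modc z = 1.
  have : modc z ^+ n.+1 == 1.
    have modcX k : modc (z ^+ k) = modc z ^+ k.
      by elim: k => [|k IH]; rewrite ?Normc.normc1// !exprS modcM IH.
    by rewrite -modcX (prim_expr_order zP) Normc.normc1.
  by rewrite pexpr_eq1 ?modc_ge0// => /eqP.
have modcX k : modc (z ^+ k) = 1.
  by elim: k => [|k IH]; rewrite ?expr0 ?Normc.normc1// exprS modcM IH z1 mulr1.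
have zz k : z ^+ k * conjc (z ^+ k) = 1 by rewrite -modc_sqrC modcX expr1n.
exists (fun j l => z ^+ (j * l)); split=> // q.
have orth (l l' : 'I_n.+1) :
    \sum_(j < n.+1) z ^+ (j * l) * conjc (z ^+ (j * l')) = (n.+1 * (l == l'))%:R.
  have [->|ll'] := eqVneq l l'.
    by under eq_bigr do rewrite zz; rewrite sumr_const card_ord muln1.
  pose w := z ^+ l * conjc (z ^+ l').
  have wX (j : nat) : z ^+ (j * l) * conjc (z ^+ (j * l')) = w ^+ j.
    by rewrite exprMn -rmorphXn -!exprM (mulnC l) (mulnC l').
  under eq_bigr do rewrite wX.
  rewrite muln0; apply/eqP; suff : (w - 1) * \sum_(j < n.+1) w ^+ j == 0.
    rewrite mulf_eq0 => /orP[|//]; rewrite subr_eq0 => /eqP w1; exfalso.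
    have : z ^+ l == z ^+ l' by rewrite -[z ^+ l]mulr1 -(zz l') mulrCA -/w w1 mulr1.
    by rewrite (eq_prim_root_expr zP) !modn_small// => /eqP/val_inj/eqP; rewrite (negPf ll').
  rewrite -subrX1 exprMn -rmorphXn -!exprM !(mulnC _ n.+1) !exprM.
  by rewrite (prim_expr_order zP) !expr1n rmorph1 mulr1 subrr.
apply: complexI; rewrite /sqnorm rmorphM rmorph_nat !rmorph_sum /=.
under eq_bigr do rewrite modc_sqrC rmorph_sum big_distrlr /=.
rewrite exchange_big /= mulr_sumr; apply: eq_bigr => l _.
rewrite exchange_big /= (bigD1 l)//= [X in _ + X]big1 ?addr0 => [|l' l'l].
  transitivity (\sum_(j < n.+1) q l * conjc (q l) * (z ^+ (j * l) * conjc (z ^+ (j * l)))).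
    by apply: eq_bigr => j _; rewrite rmorphM /= conjcK; ring.
  by rewrite -mulr_sumr orth eqxx muln1 -modc_sqrC mulrC.
transitivity (\sum_(j < n.+1) q l * conjc (q l') * (z ^+ (j * l') * conjc (z ^+ (j * l)))).
  by apply: eq_bigr => j _; rewrite rmorphM /= conjcK; ring.
by rewrite -mulr_sumr orth (negPf l'l) muln0 mulr0.
Qed.

(** The hypothesis on [P] and [Q] reads [P_j Q_i = U^i V^j], where [U] is the
    cyclic shift and [V^j] is the diagonal matrix with entries [chi j l].
    Summing [conj (chi j l) (P_j Q_(k-l))_(k,l)] over [j, k, l] gives [N^3], which
    by Cauchy-Schwarz is at most the product of the norms of the families [P]
    and [W].  The squares of these are at most [N^2 a], columnwise, and [N^3 b],
    by Parseval in [j]; so [N^6 <= N^5 a b]. *)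
Lemma shift_clock_bound n (chi : 'I_n.+1 -> 'I_n.+1 -> C) (I : finType)
    (P : 'I_n.+1 -> 'I_n.+1 -> I -> C) (Q : 'I_n.+1 -> I -> 'I_n.+1 -> C) (a b : R) :
  (forall j l, modc (chi j l) = 1) ->
  (forall q : 'I_n.+1 -> C,
    sqnorm (fun j => \sum_l q l * conjc (chi j l)) = n.+1%:R * sqnorm q) ->
  (forall j, sqopnorm_le (fun h k => P j k h) a) ->
    (forall i, sqopnorm_le (fun h l => Q i h l) b) ->
  (forall i j k l, \sum_h P j k h * Q i h l = if k - l == i then chi j l else 0) ->
  n.+1%:R <= a * b.
Proof.
move=> chi1 chiP hP hQ hPQ; set N : R := n.+1%:R.
pose J := ('I_n.+1 * ('I_n.+1 * I))%type.
pose W j k h := \sum_l Q (k - l) h l * conjc (chi j l).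
have T3 : \sum_(u : J) P u.1 u.2.1 u.2.2 * W u.1 u.2.1 u.2.2 = (N ^+ 3)%:C%C.
  rewrite -(pair_bigA _ (fun j (v : 'I_n.+1 * I) => P j v.1 v.2 * W j v.1 v.2)) /=.
  transitivity (\sum_(j < n.+1) \sum_(k < n.+1) \sum_(l < n.+1) (1 : C)).
    apply: eq_bigr => j _.
    rewrite -(pair_bigA _ (fun k h => P j k h * W j k h)) /=; apply: eq_bigr => k _.
    rewrite /W; under eq_bigr do rewrite mulr_sumr.
    rewrite exchange_big /=; apply: eq_bigr => l _.
    under eq_bigr do rewrite mulrA.
    by rewrite -mulr_suml hPQ eqxx -modc_sqrC chi1 expr1n.
  rewrite !sumr_const !card_ord -!mulrnA rmorphXn rmorph_nat -natrX.
  by congr (_%:R); rewrite !expnS expn0 muln1.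
have := modc_CauchySchwarz (fun u : J => P u.1 u.2.1 u.2.2) (fun u : J => W u.1 u.2.1 u.2.2).
rewrite T3 modc_real ger0_norm ?exprn_ge0//.
have sP : sqnorm (fun u : J => P u.1 u.2.1 u.2.2) <= N ^+ 2 * a.
  rewrite /sqnorm -(pair_bigA _ (fun j (v : 'I_n.+1 * I) => modc (P j v.1 v.2) ^+ 2)) /=.
  apply: (@le_trans _ _ (\sum_(j < n.+1) \sum_(k < n.+1) a)).
    apply: ler_sum => j _.
    rewrite -(pair_bigA _ (fun k h => modc (P j k h) ^+ 2)) /=.
    by apply: ler_sum => k _; exact: sqopnorm_le_col k (hP j).
  by rewrite !sumr_const !card_ord -mulrnA -mulr_natl natrM.
have sW : sqnorm (fun u : J => W u.1 u.2.1 u.2.2) <= N ^+ 3 * b.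
  rewrite /sqnorm -(pair_bigA _ (fun j (v : 'I_n.+1 * I) => modc (W j v.1 v.2) ^+ 2)) /=.
  rewrite exchange_big /=.
  under eq_bigr do rewrite -/(sqnorm (fun j => \sum_l Q (_ - l) _ l * conjc (chi j l))) chiP.
  rewrite -mulr_sumr exprS -mulrA ler_wpM2l//.
  rewrite /sqnorm exchange_big /=.
  apply: (@le_trans _ _ (\sum_(l < n.+1) \sum_(i < n.+1) b)).
    apply: ler_sum => l _.
    rewrite -(pair_bigA _ (fun k h => modc (Q (k - l) h l) ^+ 2)) /=.
    (* [k = i + l] turns the sum over [k] into a sum over all [Q_i] *)
    rewrite (reindex_inj (addIr l)) /=; apply: ler_sum => i _.
    by rewrite addrK; exact: sqopnorm_le_col l (hQ i).
  by rewrite !sumr_const !card_ord -mulrnA -mulr_natl natrM.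
move=> /le_trans/(_ (ler_pM (sqnorm_ge0 _) (sqnorm_ge0 _) sP sW)).
have N0 : 0 < N by rewrite ltr0Sn.
have -> : (N ^+ 3) ^+ 2 = N ^+ 5 * N by ring.
have -> : N ^+ 2 * a * (N ^+ 3 * b) = N ^+ 5 * (a * b) by ring.
by rewrite ler_pM2l// exprn_gt0.
Qed.

End Fourier.

(** * The lower bound *)

Section LowerBound.
Context {R : realType} {X : topologicalType}.
Local Notation C := R[i].
Local Notation modc := (@Normc.normc R).

Section Evaluation.
Context {Y1 Y2 : topologicalType}.
Variables (mu1 : continuousType Y1 X) (mu2 : continuousType Y2 X).
Local Notation tens := (tens (C0_act (R := R) mu1) (C0_act (R := R) mu2)).

(** This descends to the balanced tensor product exactly because the two points
    will be taken over the same point of [X] ([eval_balanced]). *)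
Definition tensor_eval (y : Y1) (z : Y2) : C0_tensor R mu1 mu2 -> C :=
  @tensor_lift C (C0 R X) (C0 R Y1) (C0 R Y2) C^o (C0_act mu1) (C0_act mu2)
    (fun f g => f y * g z).

Variables (y : Y1) (z : Y2).
Hypothesis yz : mu1 y = mu2 z.

Lemma eval_balanced : @balanced_bilinear C (C0 R X) (C0 R Y1) (C0 R Y2) C^o
  (C0_act mu1) (C0_act mu2) (fun f g => f y * g z).
Proof.
split.
- by move=> f f' g; rewrite C0_addE mulrDl.
- by move=> f g g'; rewrite C0_addE mulrDr.
- by move=> c f g; rewrite C0_scaleE -mulrA.
- by move=> c f g; rewrite C0_scaleE mulrCA.
- by move=> a f g; rewrite !C0_actE yz mulrCA mulrA.
Qed.

Lemma tensor_eval_sum (I : finType) (f : I -> C0 R Y1) (g : I -> C0 R Y2) :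
  tensor_eval y z (\sum_k tens (f k) (g k)) = \sum_k f k y * g k z.
Proof.
have lin : linear (tensor_eval y z : _ -> C^o) by exact: tensor_lift_linear eval_balanced.
have D u v : tensor_eval y z (u + v) = tensor_eval y z u + tensor_eval y z v.
  by have := lin 1 u v; rewrite !scale1r.
have Z : tensor_eval y z 0 = 0.
  by apply: (addrI (tensor_eval y z 0)); rewrite -D !addr0.
rewrite (big_morph _ D Z); apply: eq_bigr => k _.
exact: (tensor_lift_tens eval_balanced).
Qed.

End Evaluation.

Variables (Y1 Y2 : topologicalType).
Hypotheses (lY1 : locally_compact [set: Y1]) (hY1 : hausdorff_space Y1).
Hypotheses (lY2 : locally_compact [set: Y2]) (hY2 : hausdorff_space Y2).
Variables (mu1 : continuousType Y1 X) (mu2 : continuousType Y2 X).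

(** The witness is [(sum_i b_i U^i) odot (sum_j c_j V^j)] for the shift and
    clock matrices [U] and [V]; the entry [(k, l)] of the first factor is
    [b (k - l)]. *)
Lemma flip_lower n (x : X) (y : 'I_n.+1 -> Y1) (z : 'I_n.+1 -> Y2) :
  injective y -> injective z -> (forall i, mu1 (y i) = x) -> (forall i, mu2 (z i) = x) ->
  exists2 F : 'M[C0_tensor R mu1 mu2]_n.+1, haagerup_factor F (fun _ => 1) &
    forall t, haagerup_factor (map_mx (C0_flip R mu1 mu2) F) (fun _ => t) -> n.+1%:R <= t ^+ 2.
Proof.
move=> yI zI yx zx.
have [b [g [bg g01 gy gd]]] := @disjoint_bumps R Y1 lY1 hY1 _ y yI.
have [c [h [ch h01 hz hd]]] := @disjoint_bumps R Y2 lY2 hY2 _ z zI.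
have [chi [chi1 chiP]] := @Fourier_matrix R n.
pose D (k l : 'I_n.+1) : C0 R Y1 := b (k - l).
pose E (l m : 'I_n.+1) : C0 R Y2 := if l == m then \sum_j chi j l *: c j else 0.
exists (\matrix_(k, m) \sum_l tens (C0_act mu1) (C0_act mu2) (D k l) (E l m)).
  exists 'I_n.+1, D, E; split.
  - by move=> k m; rewrite mxE.
  - move=> u v; rewrite mul1r.
    have [g0|[i0 g0]] := at_most_one (gd u).
      rewrite {1}/sqnorm big1 ?sqnorm_ge0// => l _.
      rewrite big1 ?Normc.normc0 ?expr0n// => k _.
      by rewrite /D bg g0 mul0r.
    rewrite {2}/sqnorm (reindex_inj (addrI i0)) /=; apply: ler_sum => l _.
    rewrite (big_only1 (i0 + l))// => [|k kl _]; last first.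
      by rewrite /D bg g0 ?mul0r// subr_eq.
    rewrite /D addrK bg modcM modc_real exprMn -[leRHS]mul1r.
    rewrite ler_wpM2r ?sqr_ge0//; have /andP[? ?] := g01 i0 u.
    by rewrite ger0_norm// expr_le1.
  - move=> u v; rewrite mul1r; apply: ler_sum => l _.
    rewrite (big_only1 l)// => [|m]; last first.
      by rewrite eq_sym /E => /negPf-> _; rewrite mul0r.
    rewrite /E eqxx C0_sumE modcM exprMn -[leRHS]mul1r ler_wpM2r ?sqr_ge0//.
    rewrite expr_le1 ?modc_ge0//.
    have [h0|[i0 h0]] := at_most_one (hd u).
      by rewrite big1 ?Normc.normc0// => j _; rewrite C0_scaleE ch h0 mulr0.
    rewrite (big_only1 i0)// => [|j ji0 _]; last by rewrite C0_scaleE ch h0 ?mulr0.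
    rewrite C0_scaleE ch modcM chi1 mul1r modc_real.
    by have /andP[? ?] := h01 i0 u; rewrite ger0_norm.
move=> t [I [P [Q [FPQ hP hQ]]]]; rewrite expr2.
apply: (shift_clock_bound (chi := chi) (P := fun j k e => P k e (z j))
   (Q := fun i e l => Q e l (y i))) => //.
move=> i j k l.
have yz : mu2 (z j) = mu1 (y i) by rewrite yx zx.
rewrite -(tensor_eval_sum yz) -FPQ !mxE C0_flip_sum.
under eq_bigr do rewrite C0_flip_tens.
rewrite tensor_eval_sum// (big_only1 l)// => [|m ml _]; last first.
  by rewrite /E (negPf ml) C0_0E mul0r.
rewrite /E eqxx C0_sumE (big_only1 j)// => [|m mj _]; last first.
  by rewrite C0_scaleE ch hz (negPf mj) mulr0.
rewrite C0_scaleE ch hz eqxx mulr1 /D bg gy.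
by case: eqP => _; rewrite ?mulr1 ?mulr0.
Qed.

End LowerBound.

(** * From fibre cardinalities to the norm of the flip *)

Section Counting.
Context {R : realType}.
Local Open Scope ereal_scope.

Lemma counting_fibre_le (X Y : topologicalType) (mu : Y -> X) (x : X) (S : R) :
  @counting Y R (mu @^-1` [set x]) <= S%:E -> fibre_le mu x S.
Proof.
rewrite /counting; case: ifPn => [/asboolP fin|_]; last by rewrite leye_eq.
rewrite lee_fin => cS.
pose A := fset_set (mu @^-1` [set x]).
exists #|{: A}|, (fun i => val (enum_val i)); split.
- by move=> i j /val_inj /enum_val_inj.
- move=> y' yx.
  have yA : y' \in A by rewrite in_fset_set//; exact/mem_set.
  by exists (enum_rank [` yA]%fset); rewrite enum_rankK.
- by rewrite -cardfE.
Qed.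

Lemma counting_injection (X Y : topologicalType) (mu : Y -> X) (x : X) (n : nat) :
  n%:R%:E <= @counting Y R (mu @^-1` [set x]) ->
  exists2 y : 'I_n -> Y, injective y & forall i, mu (y i) = x.
Proof.
move=> h.
have [A nA Ax] : exists2 A : {fset Y}, (n <= #|` A|)%N & forall y, y \in A -> mu y = x.
  move: h; rewrite /counting; case: ifPn => [/asboolP fin|/asboolP inf _].
    rewrite lee_fin ler_nat => nA; exists (fset_set (mu @^-1` [set x])) => // y.
    by rewrite in_fset_set// => /set_mem.
  by have [A Ax nA] := infinite_set_fset n inf; exists A => // y; exact: Ax.
pose w (i : 'I_n) : A := enum_val (cast_ord (cardfE A) (widen_ord nA i)).
exists (fun i => val (w i)) => [i j /val_inj/enum_val_inj/cast_ord_inj/(congr1 val)/= ij|i].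
  exact: val_inj.
exact/Ax/valP.
Qed.

Lemma counting_nat_or_oo (T : choiceType) (A : set T) :
  @counting T R A = +oo \/ exists n : nat, @counting T R A = n%:R%:E.
Proof. by rewrite /counting; case: ifP => _; [right; eexists|left]. Qed.

Lemma nonneg_sup_le (A : set (\bar R)) (c : \bar R) : 0 <= c ->
  (forall a, A a -> a <= c) -> nonneg_sup A <= c.
Proof. by move=> c0 h; apply: ge_ereal_sup => a [->//|]; exact: h. Qed.

Lemma nonneg_sup_ge0 (A : set (\bar R)) : 0 <= nonneg_sup A.
Proof. by apply: ereal_sup_ubound; left. Qed.

Lemma nonneg_sup_ge (A : set (\bar R)) a : A a -> a <= nonneg_sup A.
Proof. by move=> Aa; apply: ereal_sup_ubound; right. Qed.

End Counting.

Section CbNorm.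
Context {R : realType} {X Y1 Y2 : topologicalType}.
Variables (lX : locally_compact [set: X]) (hX : hausdorff_space X).
Variables (lY1 : locally_compact [set: Y1]) (hY1 : hausdorff_space Y1).
Variables (lY2 : locally_compact [set: Y2]) (hY2 : hausdorff_space Y2).
Variables (mu1 : continuousType Y1 X) (mu2 : continuousType Y2 X).
Local Notation fibres x := (mine (@counting Y1 R (mu1 @^-1` [set x]))
                                 (@counting Y2 R (mu2 @^-1` [set x]))).

Lemma cb_norm_flip_le (r : R) : 0 <= r ->
  (forall x, (fibres x <= r%:E)%E) ->
  (cb_norm (C0_flip R mu1 mu2) <= (Num.sqrt r)%:E)%E.
Proof.
move=> r0 hr; set s := Num.sqrt r; have s0 : 0 <= s by exact: sqrtr_ge0.
apply: nonneg_sup_le => [|_ [n _ <-]]; first by rewrite lee_fin.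
apply: nonneg_sup_le => [|_ [F /= F1 <-]]; first by rewrite lee_fin.
apply/lee_addgt0Pr => e e0; rewrite -EFinD.
(* With this [u] the bound [(s + u) (1 + u) + u] produced by [flip_upper] is at
   most [s + e]; [(s + u)^2] replaces [r], which may be zero. *)
pose u := Num.min 1 (e / (s + 3)).
have s3 : 0 < s + 3 by lra.
have u0 : 0 < u by rewrite lt_min ltr01 divr_gt0.
have u1 : u <= 1 by rewrite ge_min lexx.
have ue : u * (s + 3) <= e by rewrite -ler_pdivlMr// ge_min lexx orbT.
have F1u : haagerup_factor F (fun _ => 1 + u) by apply: haagerup_norm_factor F1 _;
  rewrite ltrDl.
have fib x : fibre_le mu1 x ((s + u) ^+ 2) \/ fibre_le mu2 x ((s + u) ^+ 2).
  have ru : (r%:E <= ((s + u) ^+ 2)%:E)%E.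
    by rewrite lee_fin -(sqr_sqrtr r0) -/s; nra.
  have := le_trans (hr x) ru; rewrite ge_min => /orP[h|h]; [left|right];
    exact: counting_fibre_le h.
have su0 : 0 < s + u by rewrite ltr_wpDl.
have H : haagerup_factor (map_mx (C0_flip R mu1 mu2) F) (fun _ =>
  Num.sqrt ((s + u) ^+ 2) * (1 + u) + u).
  by apply: flip_upper => //; [rewrite ltr_wpDl|rewrite exprn_gt0].
rewrite sqrtr_sqr ger0_norm ?(ltW su0)// in H.
apply: le_trans (haagerup_norm_le _ H) _; rewrite ?lee_fin; nra.
Qed.

Lemma cb_norm_flip_ge (c : R) : (cb_norm (C0_flip R mu1 mu2) <= c%:E)%E ->
  forall x, (fibres x <= (c ^+ 2)%:E)%E.
Proof.
move=> hc x.
have c0 : 0 <= c by rewrite -lee_fin (le_trans _ hc)// nonneg_sup_ge0.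
have key (n : nat) : (n%:R%:E <= fibres x)%E -> n%:R <= c ^+ 2.
  case: n => [_|n]; first exact: sqr_ge0.
  rewrite le_min => /andP[/counting_injection[y yI yx] /counting_injection[z zI zx]].
  have [F F1 hF] := flip_lower (R := R) lY1 hY1 lY2 hY2 yI zI yx zx.
  have Fc : (haagerup_norm (map_mx (C0_flip R mu1 mu2) F) <= c%:E)%E.
    apply: le_trans hc.
    apply: (@le_trans _ _ (amplified_norm (C0_flip R mu1 mu2) n.+1)).
      by apply: nonneg_sup_ge; exists F => //=; exact: haagerup_norm_le.
    by apply: nonneg_sup_ge; exists n.+1.
  rewrite leNgt; apply/negP => cn.
  have sq : Num.sqrt n.+1%:R ^+ 2 = n.+1%:R :> R by rewrite sqr_sqrtr.
  have s0 := sqrtr_ge0 (n.+1%:R : R); set s := Num.sqrt _ in sq s0.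
  have cs : c < s by rewrite -(@ltr_sqr _ c s) ?nnegrE// sq.
  (* any bound strictly between [c] and [s] gives a contradiction *)
  have := hF _ (haagerup_norm_factor Fc (_ : c < (c + s) / 2)).
  by rewrite -sq => /(_ ltac:(lra)); nra.
have [H|[n Hn]] : fibres x = +oo%E \/ exists n : nat, fibres x = n%:R%:E.
- have [->|[n1 ->]] := counting_nat_or_oo (R := R) (mu1 @^-1` [set x]);
  have [->|[n2 ->]] := counting_nat_or_oo (R := R) (mu2 @^-1` [set x]).
  + by left; rewrite minxx.
  + by right; exists n2; rewrite min_r// leey.
  + by right; exists n1; rewrite min_l// leey.
  + by right; have [h|h] := leP n1%:R%:E n2%:R%:E; [exists n1|exists n2].
- have := key (Num.trunc (c ^+ 2)).+1; rewrite H leey => /(_ isT).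
  by rewrite leNgt truncnS_gt.
- by rewrite Hn lee_fin; apply: key; rewrite Hn.
Qed.

End CbNorm.

Theorem proposition14 (R : realType) (X Y1 Y2 : topologicalType)
    (hX : hausdorff_space X) (lX : locally_compact [set: X])
    (hY1 : hausdorff_space Y1) (lY1 : locally_compact [set: Y1])
    (hY2 : hausdorff_space Y2) (lY2 : locally_compact [set: Y2])
    (mu1 : continuousType Y1 X) (mu2 : continuousType Y2 X) :
  cb_norm (C0_flip R mu1 mu2) =
  sqrte (nonneg_sup
    [set mine (@counting Y1 R (mu1 @^-1` [set x]))
              (@counting Y2 R (mu2 @^-1` [set x])) | x in [set: X]]).
Proof.
apply/eqP; rewrite eq_le; apply/andP; split.
- set M := nonneg_sup _.
  have M0 : (0 <= M)%E by exact: nonneg_sup_ge0.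
  have HM x : (mine (@counting Y1 R (mu1 @^-1` [set x]))
                    (@counting Y2 R (mu2 @^-1` [set x])) <= M)%E.
    by apply: nonneg_sup_ge; exists x.
  case: M M0 HM => [r|_ _|//]; last by rewrite leey.
  by rewrite lee_fin => r0 hr; exact: cb_norm_flip_le.
- case E : (cb_norm _) => [c||]; last 2 first.
  + by rewrite leey.
  + by have := nonneg_sup_ge0 [set amplified_norm (C0_flip R mu1 mu2) n | n in [set: nat]];
      rewrite -/(cb_norm _) E.
  have c0 : 0 <= c by rewrite -lee_fin -E nonneg_sup_ge0.
  rewrite -[leRHS](_ : sqrte (c ^+ 2)%:E = _); last by rewrite /= sqrtr_sqr ger0_norm.
  rewrite lee_sqrt ?lee_fin ?sqr_ge0//.
  apply: nonneg_sup_le => [|_ [x _ <-]]; first by rewrite lee_fin sqr_ge0.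
  by apply: cb_norm_flip_ge; rewrite ?E.
Qed.
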